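(* Let $1<p<\infty$, $p\neq 2$, and let $V(p)=2\,\frac{p-1}{p}\,C-I$ act on the Hardy space $H^p(\mathbb{C}_+)$, where $C$ is the Cesàro operator and $I$ is the identity. Then its operator norm satisfies $\|V(p)\|_p>1$. Moreover, $$\|V(p)\|_p^p>\exp\bigl(R(p-2)\bigr),$$ where $$R(s)=\frac{1}{24}\,\frac{s^2}{\kappa(\kappa+s)(2\kappa+s)},\qquad \kappa=1+\frac{1}{\sqrt{12}}.$$
   Context: $\mathbb{C}_+=\{z\in\mathbb{C}:\operatorname{Im} z>0\}$ is the open upper half-plane. For $1\le p<\infty$, the Hardy space $H^p(\mathbb{C}_+)$ is the Banach space of functions $f$ analytic in $\mathbb{C}_+$ with finite norm $$\|f\|_p=\left[\sup_{y>0}\frac{1}{2\pi}\int_{-\infty}^{\infty}|f(x+iy)|^p\,dx\right]^{1/p}.$$ The Cesàro operator $C$ is defined by $$(Cf)(z)=\frac1z\int_0^z f(\zeta)\,d\zeta,\qquad z\in\mathbb{C}_+,$$ where the integral may be taken along the straight segment from $0$ to $z$. For $1<p<\infty$ it is a known fact that $C$ is a bounded operator on $H^p(\mathbb{C}_+)$. $\|V(p)\|_p$ denotes the operator norm of $V(p)$ as a bounded linear operator from $H^p(\mathbb{C}_+)$ to itself. *)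

(* Defs.v *)
From mathcomp Require Import all_boot all_order all_algebra.
From mathcomp Require Import all_classical all_reals all_analysis.
From mathcomp Require Export complex.
Set Implicit Arguments.
Unset Strict Implicit.
Unset Printing Implicit Defensive.
Import Order.TTheory GRing.Theory Num.Theory.
Import numFieldNormedType.Exports.
Local Open Scope classical_set_scope.
Local Open Scope ring_scope.
Local Open Scope complex_scope.

Section HardyUpperHalfPlane.
Variable R : realType.

(* Functions on the half-plane are represented by total functions
   R[i] -> R[i]; every notion below reads only their values on this set. *)
Definition upper_half_plane : set R[i] := [set z | 0 < complex.Im z].

(* [derivable f z 1] over the scalar field R[i] says that the complex
   difference quotient of f at z converges. *)
Definition analytic_uhp (f : R[i] -> R[i]) : Prop :=
  forall z, upper_half_plane z -> derivable (f : R[i]^o -> R[i]^o) z 1.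

(* Extended real: +oo when the supremum is infinite. *)
Definition hardy_norm (p : R) (f : R[i] -> R[i]) : \bar R :=
  (ereal_sup [set ((2 * pi)^-1)%:E *
                \int[lebesgue_measure]_x (ComplexField.Normc.normc (f (x +i* y)) `^ p)%:E
             | y in [set y : R | (0 < y)%R]] `^ p^-1)%E.

Definition hardy_space (p : R) : set (R[i] -> R[i]) :=
  [set f | analytic_uhp f /\ (hardy_norm p f < +oo)%E].

(* The integral along the segment, parametrised by t |-> t z.  For f in the
   Hardy space, 1 < p, t |-> f (t z) is Lebesgue integrable near 0, although f
   itself need not have a limit there. *)
Definition segment_integral (f : R[i] -> R[i]) (z : R[i]) : R[i] :=
  z * ((\int[lebesgue_measure]_(t in `]0%R, 1%R]) complex.Re (f (t%:C * z)))
       +i* (\int[lebesgue_measure]_(t in `]0%R, 1%R])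
              complex.Im (f (t%:C * z)))).

Definition cesaro (f : R[i] -> R[i]) : R[i] -> R[i] :=
  fun z => z^-1 * segment_integral f z.

Definition cesaro_V (p : R) (f : R[i] -> R[i]) : R[i] -> R[i] :=
  fun z => (2 * ((p - 1) / p))%:C * cesaro f z - f z.

(* Extended real, so that it is defined without a proof of boundedness: for a
   linear T it is +oo exactly when T is unbounded. *)
Definition operator_norm (p : R) (T : (R[i] -> R[i]) -> (R[i] -> R[i])) :
    \bar R :=
  ereal_sup [set hardy_norm p (T f)
            | f in [set f | hardy_space p f /\ (hardy_norm p f <= 1)%E]].

Definition kappa : R := 1 + (Num.sqrt 12)^-1.

Definition Rfun (s : R) : R :=
  24^-1 * (s ^+ 2 / (kappa * (kappa + s) * (2 * kappa + s))).

End HardyUpperHalfPlane.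

Arguments kappa {R}.

(* Main.v *)
Require Import Defs.
From mathcomp Require Import all_boot all_order all_algebra.
From mathcomp Require Import all_classical all_reals all_analysis.
From mathcomp Require Import measurable_realfun ring lra.
Set Implicit Arguments.
Unset Strict Implicit.
Unset Printing Implicit Defensive.
Import Order.TTheory GRing.Theory Num.Theory.
Import numFieldNormedType.Exports.
Local Open Scope classical_set_scope.
Local Open Scope ring_scope.

(** If f = H' with H 0 = 0, then V f = c H / z - f with c = 2 (p - 1) / p, so a
    single rational H yields an explicit lower bound for the norm.

    For p > 2 take H = z / (z + i)^2.  On the real axis |f|^2 = (1 + x^2)^(-2)
    and t = |V f|^2 / |f|^2 has mean 1 for the weight |f|^p, so Jensen's
    inequality for t^(p/2), sharpened by a quadratic term, gives
    |V f|_p^p / |f|_p^p >= 1 + const * variance of t.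

    For p < 2 take H = z^2 / (2 (z + i)^2), so that |f| = |z| / |z + i|^3 and
    |V f|^2 = |f|^2 (((p - 1) / p)^2 x^2 + 1 / p^2) on the axis.  Concavity of
    s^(p/2) reduces the integral of |V f|^p to the moments of order p and 2 p of
    (1 + x^2)^(-3p/2), whose ratio is rational in p by x -> 1 / x and an
    integration by parts.  Here |f(x + i y)| is not monotone in y, and
    the bound of the line integrals by the boundary value is checked by scaling
    x = (1 + y) t.  The norm of V f is bounded below by Fatou's lemma as y -> 0. *)

(** * Integrals over the half-line *)

(** As p tends to 2 the lower bounds on both sides tend to 1, and so does exp R, so the margin near
    2 decides the form of the argument. Above 2, R(p - 2) vanishes to second order; plain Jensen
    would give only 1, and the variance term supplies a multiple of (p - 2)^2 that beats it. For p <
    2 the same function is useless: t still has mean 1, but s^(p/2) is now concave, so the ratio is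
    at most 1. The second function gains already at first order in 2 - p, which leaves room for
    crude constants afterwards.

    Bernoulli's inequality, in its concave and convex forms, is the source of almost all estimates
    of real powers. In the last step exp R is replaced by 1 / (1 - R), so that only polynomial
    inequalities remain. They are split at p = 4 and at p = 3/2, where one set of elementary bounds
    becomes too weak. *)

Section HalfLine.
Context {R : realType}.
Notation mu := (@lebesgue_measure R).
Implicit Types (f g A B F dF : R -> R) (k x y : R).

(** [n.+2] keeps the endpoints strictly ordered already at [n = 0]. The interval is symmetric under
    x -> k^2 / x, and multiplication by [k] carries the one for [1] onto the one for [k], so
    substitutions can be made on each compact piece before the limit. *)
Definition exhaustion k (n : nat) : set R := `[k * n.+2%:R^-1, k * n.+2%:R].

Lemma exhaustion_gt0 k n x : 0 < k -> exhaustion k n x -> 0 < x.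
Proof.
move=> k0; rewrite /exhaustion/= in_itv/= => /andP[+ _]; apply: lt_le_trans.
by rewrite mulr_gt0// invr_gt0.
Qed.

Lemma bigcup_exhaustion k : 0 < k -> \bigcup_n exhaustion k n = `]0, +oo[%classic.
Proof.
move=> k0; apply/seteqP; split => x /=.
  by move=> [n _ /(exhaustion_gt0 k0)]; rewrite in_itv/= andbT.
rewrite in_itv/= andbT => x0.
pose y := x / k; have y0 : 0 < y by rewrite divr_gt0.
have -> : x = k * y by rewrite mulrC divfK// gt_eqF.
exists (Num.truncn (y + y^-1)) => //; rewrite /exhaustion/= in_itv/=.
rewrite !ler_pM2l//.
have := truncnS_gt (y + y^-1); set N := Num.truncn _ => yN.
have yV : 0 < y^-1 by rewrite invr_gt0.
have yN2 : y + y^-1 < N.+2%:R by apply: lt_trans yN _; rewrite ltr_nat.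
apply/andP; split; last by lra.
by rewrite -[y in leRHS]invrK lef_pV2 ?posrE//; lra.
Qed.

Lemma continuous_gt0_measurable f : (forall x, 0 < x -> {for x, continuous f}) ->
  measurable_fun (`]0, +oo[ : set R) f.
Proof.
move=> cf; apply: open_continuous_measurable_fun => // x.
by rewrite inE/= in_itv/= andbT => /cf.
Qed.

Lemma cvg_integral_exhaustion k f : 0 < k -> (forall x, 0 < x -> 0 <= f x) ->
  (forall x, 0 < x -> {for x, continuous f}) ->
  (\int[mu]_(x in exhaustion k n) (f x)%:E @[n --> \oo] -->
   \int[mu]_(x in `]0%R, +oo[) (f x)%:E)%E.
Proof.
move=> k0 f0 cf; rewrite -(bigcup_exhaustion k0).
apply: ge0_nondecreasing_set_cvg_integral.
- apply/nondecreasing_seqP => n; apply/subsetPset => x.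
  rewrite /exhaustion/= !in_itv/= => /andP[nx xn]; apply/andP; split.
    by apply: le_trans nx; rewrite ler_pM2l// lef_pV2 ?posrE// ler_nat.
  by apply: le_trans xn _; rewrite ler_pM2l// ler_nat.
- by move=> n; exact: measurable_itv.
- move=> n; apply/measurable_EFinP.
  apply: measurable_funS (continuous_gt0_measurable cf) => //.
  by move=> x /(exhaustion_gt0 k0); rewrite /= in_itv/= andbT.
- by move=> n x /(exhaustion_gt0 k0) x0; rewrite lee_fin f0.
Qed.

Lemma continuous_exhaustion k f n : 0 < k ->
  (forall x, 0 < x -> {for x, continuous f}) ->
  {within exhaustion k n, continuous f}.
Proof.
move=> k0 cf; apply: continuous_in_subspaceT => x.
by rewrite inE => /(exhaustion_gt0 k0) /cf.
Qed.

Lemma exhaustion_lt k n : 0 < k -> k * n.+2%:R^-1 < k * n.+2%:R :> R.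
Proof.
move=> k0; rewrite ltr_pM2l//.
have : 1 < n.+2%:R :> R by rewrite ltr1n.
by move=> n1; rewrite (lt_trans _ n1)// invf_lt1// (lt_trans _ n1).
Qed.

Lemma integrable_exhaustion k f n : 0 < k ->
  (forall x, 0 < x -> {for x, continuous f}) ->
  mu.-integrable (exhaustion k n) (EFin \o f).
Proof.
move=> k0 cf; apply: continuous_compact_integrable; first exact: segment_compact.
exact: continuous_exhaustion.
Qed.

Lemma derivable_gt0_LRcontinuous F dF (a b : R) : 0 < a -> a < b ->
  (forall x, 0 < x -> is_derive x 1 F (dF x)) -> derivable_oo_LRcontinuous F a b.
Proof.
move=> a0 ab dFE.
have cF x : 0 < x -> {for x, continuous F}.
  by move=> x0; apply/differentiable_continuous/derivable1_diffP; case: (dFE _ x0).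
split => [x||].
- by rewrite in_itv/= => /andP[ax _]; case: (dFE _ (lt_trans a0 ax)).
- by apply: cvg_at_right_filter; exact: cF.
- by apply: cvg_at_left_filter; apply: cF; exact: lt_trans ab.
Qed.

(** On each compact piece the derivative contributes only boundary values of [F], which vanish at
    both ends. An inequality makes sense even for infinite integrals; an identity comes from using
    [F] and then [- F]. *)
Lemma le_integral_derive F dF A B :
  (forall x, 0 < x -> 0 <= A x) -> (forall x, 0 < x -> 0 <= B x) ->
  (forall x, 0 < x -> {for x, continuous A}) ->
  (forall x, 0 < x -> {for x, continuous B}) ->
  (forall x, 0 < x -> {for x, continuous dF}) ->
  (forall x, 0 < x -> is_derive x 1 F (dF x)) ->
  F x @[x --> 0^'+] --> (0 : R) -> F x @[x --> +oo%R] --> (0 : R) ->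
  (forall x, 0 < x -> B x + dF x <= A x) ->
  (\int[mu]_(x in `]0%R, +oo[) (B x)%:E <= \int[mu]_(x in `]0%R, +oo[) (A x)%:E)%E.
Proof.
move=> A0 B0 cA cB cdF FdF F0 Fy BA.
have Fn n : (\int[mu]_(x in exhaustion 1 n) (B x)%:E +
    (F (1 * n.+2%:R) - F (1 * n.+2%:R^-1))%:E <=
    \int[mu]_(x in exhaustion 1 n) (A x)%:E)%E.
  have a0 : 0 < 1 * n.+2%:R^-1 :> R by rewrite mul1r invr_gt0.
  have <- : (\int[mu]_(x in exhaustion 1 n) (dF x)%:E =
      (F (1 * n.+2%:R) - F (1 * n.+2%:R^-1))%:E)%E.
    rewrite EFinB; apply: continuous_FTC2.
    - exact: exhaustion_lt.
    - exact: continuous_exhaustion.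
    - by apply: derivable_gt0_LRcontinuous FdF => //; exact: exhaustion_lt.
    - move=> x; rewrite in_itv/= => /andP[ax _].
      by rewrite derive1E; case: (FdF _ (lt_trans a0 ax)).
  rewrite -integralD_EFin//=; [|exact: measurable_itv|exact: integrable_exhaustion..].
  apply: le_integral => //=.
  - exact: measurable_itv.
  - apply: (@integrable_exhaustion 1 (fun x => B x + dF x)) => // x x0.
    by apply: continuousD; [exact: cB|exact: cdF].
  - exact: integrable_exhaustion.
  - by move=> x; rewrite inE => /(exhaustion_gt0 ltr01) x0; rewrite -EFinD lee_fin BA.
have cvA := cvg_integral_exhaustion ltr01 A0 cA.
have cvB := cvg_integral_exhaustion ltr01 B0 cB.
have cvF : ((F (1 * n.+2%:R) - F (1 * n.+2%:R^-1))%:E @[n --> \oo] --> 0)%E.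
  apply: cvg_EFin; first exact: nearW.
  rewrite [X in _ --> X](_ : _ = 0 - 0 :> R); last by rewrite subr0.
  apply: cvgB.
  - move/cvg_pinftyP : Fy; apply; under eq_fun do rewrite mul1r.
    apply/cvgryPge => r; near=> n; rewrite (@le_trans _ _ n%:R)//; last first.
      by rewrite ler_nat; do 2 apply: leqW.
    by near: n; exact: nbhs_infty_ger.
  - move/cvg_at_rightP : F0; apply; split => [n|]; first by rewrite mul1r invr_gt0.
    under eq_fun do rewrite mul1r.
    by have := @cvg_harmonic R; rewrite -cvg_shiftS.
have := cvgeD _ cvB cvF.
have fin0 : (0 : \bar R)%E \is a fin_num by [].
rewrite adde0 => /(_ _ (fin_num_adde_defl _ fin0)) cvBF.
rewrite -(cvg_lim (@ereal_hausdorff R) cvA) -(cvg_lim (@ereal_hausdorff R) cvBF).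
apply: lee_lim; [by apply/cvg_ex; eexists; exact: cvBF|by apply/cvg_ex; eexists; exact: cvA|].
by apply: nearW => n; exact: Fn.
Unshelve. all: by end_near. Qed.

Lemma integral_scale k f : 0 < k -> (forall x, 0 < x -> 0 <= f x) ->
  (forall x, 0 < x -> {for x, continuous f}) ->
  (\int[mu]_(x in `]0%R, +oo[) (f x)%:E =
   \int[mu]_(x in `]0%R, +oo[) (f (k * x) * k)%:E)%E.
Proof.
move=> k0 f0 cf.
have dk x : is_derive x (1 : R) ( *%R k) k.
  have -> : *%R k = k *: (id : R -> R^o) by apply/funext => y.
  by apply: is_derive_eq; rewrite /GRing.scale/= mulr1.
have derk : derive1 ( *%R k : R -> R) = cst k by apply/funext => x; rewrite derive1E; case: (dk x).
have cfk x : 0 < x -> {for x, continuous (fun x => f (k * x) * k)}.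
  move=> x0; apply: continuousM; last exact: cst_continuous.
  apply: continuous_comp; first exact: mulrl_continuous.
  by apply: cf; rewrite mulr_gt0.
have cv1 := cvg_integral_exhaustion k0 f0 cf.
have cv2 := cvg_integral_exhaustion ltr01 _ cfk.
rewrite -(cvg_lim (@ereal_hausdorff R) cv1) -(cvg_lim (@ereal_hausdorff R) (cv2 _)); last first.
  by move=> x x0; rewrite mulr_ge0// ?(ltW k0)// f0// mulr_gt0.
congr (limn _).
apply/funext => n.
  have a0 : 0 < 1 * n.+2%:R^-1 :> R by rewrite mul1r invr_gt0.
  have ek : exhaustion k n = `[k * (1 * n.+2%:R^-1), k * (1 * n.+2%:R)]%classic.
    by rewrite !mul1r.
  rewrite ek (integration_by_substitution_increasing (F := *%R k)).
  - by apply: eq_integral => x _ /=; rewrite /GRing.mul/= derk.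
  - exact/ltW/exhaustion_lt.
  - by move=> x y _ _; rewrite ltr_pM2l.
  - by rewrite derk => x _; exact: cst_continuous.
  - by rewrite derk; exact: is_cvg_cst.
  - by rewrite derk; exact: is_cvg_cst.
  - by apply: (@derivable_gt0_LRcontinuous _ (cst k)) => //; exact: exhaustion_lt.
  - by rewrite -ek; exact: continuous_exhaustion.
Qed.

Lemma integral_inv f : (forall x, 0 < x -> 0 <= f x) ->
  (forall x, 0 < x -> {for x, continuous f}) ->
  (\int[mu]_(x in `]0%R, +oo[) (f x)%:E =
   \int[mu]_(x in `]0%R, +oo[) (f x^-1 * (x ^+ 2)^-1)%:E)%E.
Proof.
move=> f0 cf.
have dV x : 0 < x -> is_derive x (1 : R) (fun x => x^-1) (- (x ^+ 2)^-1).
  move=> x0; have x_neq0 : id x != 0 by rewrite gt_eqF.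
  apply: is_derive_eq; first exact: (@is_deriveV R id x 1 1 x_neq0 (is_derive_id _ _)).
  by rewrite /GRing.scale/= mulr1.
have cV x : 0 < x -> {for x, continuous (fun x : R => (x ^+ 2)^-1)}.
  move=> x0; apply: continuousV; first by rewrite sqrf_eq0 gt_eqF.
  exact: exprn_continuous.
have cfV x : 0 < x -> {for x, continuous (fun x => f x^-1 * (x ^+ 2)^-1)}.
  move=> x0; apply: continuousM; last exact: cV.
  apply: continuous_comp; first by apply: inv_continuous; rewrite gt_eqF.
  by apply: cf; rewrite invr_gt0.
have cv1 := cvg_integral_exhaustion ltr01 f0 cf.
have cv2 := cvg_integral_exhaustion ltr01 _ cfV.
rewrite -(cvg_lim (@ereal_hausdorff R) cv1) -(cvg_lim (@ereal_hausdorff R) (cv2 _)); last first.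
  by move=> x x0; rewrite mulr_ge0// ?invr_ge0 ?sqr_ge0// f0// invr_gt0.
congr (limn _).
apply/funext => n.
  have a0 : 0 < 1 * n.+2%:R^-1 :> R by rewrite mul1r invr_gt0.
  have ab := @exhaustion_lt 1 n ltr01.
  have derV (x : R) : 0 < x -> derive1 (fun x : R => x^-1) x = - (x ^+ 2)^-1.
    by move=> x0; rewrite derive1E; case: (dV x x0).
  have derVn (x : R) : 0 < x -> \forall y \near x, - (y ^+ 2)^-1 = derive1 (fun x : R => x^-1) y.
    by move=> x0; near=> y; rewrite derV//; near: y; exact: lt_nbhsr.
  have cderV (x : R) : 0 < x -> derive1 (fun x : R => x^-1) y @[y --> x] --> - (x ^+ 2)^-1.
    move=> x0; apply: (cvg_trans (near_eq_cvg (derVn _ x0))).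
    apply: cvgN; exact: (cV x x0).
  have ek : exhaustion 1 n = `[(1 * n.+2%:R)^-1, (1 * n.+2%:R^-1)^-1]%classic.
    by rewrite /exhaustion !mul1r invrK.
  rewrite [in LHS]ek (integration_by_substitution_decreasing (F := fun x => x^-1)).
  - apply: eq_integral => x /=; rewrite inE => /(exhaustion_gt0 ltr01) x0.
    by rewrite /= /GRing.mul/= /GRing.opp/= derV// opprK.
  - exact/ltW.
  - move=> x y; rewrite !in_itv/= => /andP[ax _] /andP[ay _].
    by rewrite ltf_pV2 ?posrE// (lt_le_trans a0).
  - move=> x; rewrite in_itv/= => /andP[ax _].
    by rewrite /continuous_at derV ?(lt_trans a0)//; apply: cderV; exact: lt_trans ax.
  - apply/cvg_ex; exists (- ((1 * n.+2%:R^-1) ^+ 2)^-1).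
    by apply: cvg_at_right_filter; exact: cderV.
  - apply/cvg_ex; exists (- ((1 * n.+2%:R) ^+ 2)^-1).
    by apply: cvg_at_left_filter; apply: cderV; exact: lt_trans ab.
  - by apply: (@derivable_gt0_LRcontinuous _ (fun x => - (x ^+ 2)^-1)).
  - by rewrite -ek; exact: continuous_exhaustion.
Unshelve. all: by end_near. Qed.

End HalfLine.

(** * Limits of real powers *)

Section PowerLimits.
Context {R : realType}.

Lemma cvg_exp (T : Type) (F : set_system T) {FF : Filter F} (g : T -> R) (l : R) n :
  g t @[t --> F] --> l -> g t ^+ n @[t --> F] --> l ^+ n.
Proof. by move=> gl; exact: cvg_comp gl (@exprn_continuous R n l). Qed.

(** At the limit 0 the power need not be differentiable, so this case is proved from the definition,
    with threshold e^(1/q). *)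
Lemma cvg_powR_ge0 (T : Type) (F : set_system T) {FF : Filter F} (g : T -> R) (l q : R) :
  0 < q -> (forall t, 0 <= g t) -> 0 <= l ->
  g t @[t --> F] --> l -> g t `^ q @[t --> F] --> l `^ q.
Proof.
move=> q0 g0; rewrite le_eqVlt => /predU1P[<- gl|l0 gl].
  rewrite powR0 ?gt_eqF//; apply/cvgrPdist_lt => e e0.
  have eq0 : 0 < e `^ q^-1 by exact: powR_gt0.
  move/cvgrPdist_lt/(_ _ eq0) : gl; apply: filterS => t.
  rewrite !sub0r !normrN !ger0_norm ?powR_ge0// => gt.
  have qn0 : q != 0 by rewrite gt_eqF.
  rewrite -[ltRHS]powRr1 ?(ltW e0)// -(mulVf qn0) powRrM.
  by rewrite gt0_ltr_powR ?nnegrE ?powR_ge0.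
move: gl; have cl : {for l, continuous (fun x : R => x `^ q)}; last first.
  by move=> gl; exact: cvg_comp gl cl.
apply/differentiable_continuous/derivable1_diffP.
by apply: derivable_powR; rewrite in_itv/= andbT.
Qed.

Lemma cvg_powR_gt0 (T : Type) (F : set_system T) {FF : Filter F} (g : T -> R) (l q : R) :
  0 < l -> g t @[t --> F] --> l -> g t `^ q @[t --> F] --> l `^ q.
Proof.
move=> l0; have cl : {for l, continuous (fun x : R => x `^ q)}; last first.
  by move=> gl; exact: cvg_comp gl cl.
apply/differentiable_continuous/derivable1_diffP.
by apply: derivable_powR; rewrite in_itv/= andbT.
Qed.

End PowerLimits.

(** * Products of powers of x and of 1 + x^2 *)

Section PowerProducts.
Context {R : realType}.
Implicit Types (a d x eps C : R) (F : R -> R).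

(** Up to linear combinations this family is stable under products, differentiation and x -> 1 / x.
    The weights and the boundary terms of the integrations by parts are all of this form. *)
Definition pw a d x : R := x `^ a * (1 + x ^+ 2) `^ d.

Lemma onesqr_gt0 x : 0 < 1 + x ^+ 2.
Proof. by rewrite ltr_wpDr ?sqr_ge0. Qed.

Lemma onesqr_ge1 x : 1 <= 1 + x ^+ 2.
Proof. by rewrite lerDl sqr_ge0. Qed.

Lemma pw_ge0 a d x : 0 <= pw a d x.
Proof. by rewrite mulr_ge0 ?powR_ge0. Qed.

Lemma pw_gt0 a d x : 0 < x -> 0 < pw a d x.
Proof. by move=> x0; rewrite mulr_gt0 ?powR_gt0// onesqr_gt0. Qed.

Lemma is_derive_pw a d x : 0 < x ->
  is_derive x (1 : R) (pw a d) (a * pw (a - 1) d x + 2 * d * pw (a + 1) (d - 1) x).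
Proof.
move=> x0.
pose q : R -> R := cst 1 + (id : R -> R) ^+ 2.
have qE y : q y = 1 + y ^+ 2 by [].
have dq : is_derive x (1 : R) q (2 * x).
  have dx2 := is_deriveX 2 (is_derive_id x (1 : R)).
  apply: (is_derive_eq (is_deriveD (is_derive_cst (1 : R) x (1 : R)) dx2)).
  by rewrite add0r /GRing.scale/= mulr1 expr1.
have d2 : is_derive x (1 : R) ((@powR R ^~ d) \o q) (d * (1 + x ^+ 2) `^ (d - 1) * (2 * x)).
  by apply: is_derive1_comp; rewrite qE; exact: is_derive1_powR (onesqr_gt0 x).
have d1 := is_derive1_powR a x0.
have -> : pw a d = (@powR R ^~ a) * ((@powR R ^~ d) \o q) by apply/funext.
apply: (is_derive_eq (is_deriveM d1 d2)).
have -> : pw (a + 1) (d - 1) x = x `^ a * x * (1 + x ^+ 2) `^ (d - 1).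
  by rewrite /pw powRD ?(gt_eqF x0) ?implybT// powRr1 ?ltW.
rewrite /pw /GRing.scale/= qE.
ring.
Qed.

Lemma continuous_pw a d x : 0 < x -> {for x, continuous (pw a d)}.
Proof.
move=> x0; have [df _] := is_derive_pw a d x0.
exact/differentiable_continuous/derivable1_diffP.
Qed.

Lemma pwD a d a' d' x : 0 < x -> pw a d x * pw a' d' x = pw (a + a') (d + d') x.
Proof.
move=> x0; have xn0 : x != 0 by rewrite gt_eqF.
have qn0 : 1 + x ^+ 2 != 0 by rewrite gt_eqF ?onesqr_gt0.
by rewrite /pw mulrACA -!powRD ?xn0 ?qn0 ?implybT.
Qed.

(** x / (1 + x^2) tends to 0 at both ends of the half-line, so a positive power of it controls both
    boundary terms at once. *)
Lemma cvg_dominated_pw F C eps : 0 < eps ->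
  (forall x, 0 < x -> `|F x| <= C * pw eps (- eps) x) ->
  F x @[x --> 0^'+] --> (0 : R) /\ F x @[x --> +oo%R] --> (0 : R).
Proof.
move=> e0 FC.
pose g x : R := (`|x| / (1 + x ^+ 2)).
have g0 x : 0 <= g x by rewrite divr_ge0// ltW// onesqr_gt0.
have gE x : 0 < x -> pw eps (- eps) x = g x `^ eps.
  move=> x0; rewrite /pw /g ger0_norm ?(ltW x0)// powRM ?(ltW x0)//; last first.
    by rewrite invr_ge0 ltW// onesqr_gt0.
  by rewrite -powR_inv1 ?(ltW (onesqr_gt0 _))// -powRrM mulN1r.
have squeeze (G : set_system R) : Filter G -> (\forall x \near G, 0 < x) ->
    g x @[x --> G] --> (0 : R) -> F x @[x --> G] --> (0 : R).
  move=> FG Gpos gG.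
  have H : C * g x `^ eps @[x --> G] --> (0 : R).
    rewrite [X in _ --> X](_ : _ = C * (0 `^ eps)); last by rewrite powR0 ?gt_eqF// mulr0.
    by apply: cvgM; [exact: cvg_cst|exact: cvg_powR_ge0].
  apply/norm_cvg0P; apply: (squeeze_cvgr _ (cvg_cst 0) H).
  near=> x; rewrite normr_ge0/=.
  have x0 : 0 < x by near: x.
  by rewrite -gE// FC.
split; apply: squeeze.
- exact: nbhs_right_gt.
- apply: cvg_at_right_filter.
  rewrite [X in _ --> X](_ : _ = g 0); last by rewrite /g normr0 mul0r.
  apply: cvgM; first exact: norm_continuous.
  apply: cvgV; first by rewrite expr0n addr0 oner_eq0.
  by apply: cvgD; [exact: cvg_cst|exact: exprn_continuous].
- exact: nbhs_pinfty_gt.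
- apply: (squeeze_cvgr _ (cvg_cst 0) (_ : (fun x => x^-1) @ +oo%R --> (0 : R))).
    near=> x; rewrite g0/=.
    have x0 : 0 < x by near: x; exact: nbhs_pinfty_gt.
    rewrite /g ger0_norm ?(ltW x0)// ler_pdivrMr ?onesqr_gt0//.
    by rewrite mulrDr mulr1 expr2 mulKf ?gt_eqF// lerDr invr_ge0 ltW.
  by apply/gtr0_cvgV0; [exact: nbhs_pinfty_gt|exact: cvg_id].
Unshelve. all: by end_near. Qed.

End PowerProducts.

(** * Bernoulli's inequality for real exponents *)

Section PowerInequalities.
Context {R : realType}.
Implicit Types (a d x y r s : R).

(** Young's inequality for the product of y^s and 1, with conjugate exponents 1 / s and 1 / (1 - s);
    s = 0 and s = 1, where one of them is infinite, are treated apart. *)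
Lemma powR_bernoulli_le s y : 0 <= s <= 1 -> 0 <= y -> y `^ s <= 1 + s * (y - 1).
Proof.
move=> /andP[]; rewrite le_eqVlt => /predU1P[<- _ _|s0].
  by rewrite powRr0 mul0r addr0.
rewrite le_eqVlt => /predU1P[-> y0|s1 y0]; first by rewrite powRr1// mul1r subrKC.
have sn0 : s != 0 by rewrite gt_eqF.
have s1' : 0 < 1 - s by rewrite subr_gt0.
have := @conjugate_powR R (y `^ s) 1 s^-1 (1 - s)^-1 (powR_ge0 _ _) ler01.
rewrite !invr_gt0 => /(_ s0 s1'); rewrite !invrK subrKC => /(_ erefl).
rewrite mulr1 powR1 -powRrM mulfV// powRr1// => /le_trans; apply.
by lra.
Qed.

(** The concave case with exponent 1 / r, applied to x^r. *)
Lemma powR_bernoulli_ge r x : 1 <= r -> 0 <= x -> 1 + r * (x - 1) <= x `^ r.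
Proof.
move=> r1 x0; have r0 : 0 < r by apply: lt_le_trans r1.
have rV : 0 <= r^-1 <= 1 by rewrite invr_ge0 (ltW r0) invf_le1.
have := powR_bernoulli_le rV (powR_ge0 x r).
rewrite -powRrM mulfV ?gt_eqF// powRr1// => xle.
have : r * x <= r * (1 + r^-1 * (x `^ r - 1)) by rewrite ler_pM2l.
by rewrite mulrDr mulr1 mulVKf ?gt_eqF//; lra.
Qed.

Lemma sqr_powR x r : 0 <= x -> (x ^+ 2) `^ (r / 2) = x `^ r.
Proof. by move=> x0; rewrite -powR_mulrn// -powRrM mulrC divfK. Qed.

Lemma pw_mul_powR a d r x : 0 < x -> pw a d x * x `^ r = pw (a + r) d x.
Proof.
move=> x0; rewrite -[d in RHS]addr0 -pwD// /pw; congr (_ * _).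
by rewrite powRr0 mulr1.
Qed.

Lemma ler_pw a d d' x : d <= d' -> pw a d x <= pw a d' x.
Proof.
move=> dd'; rewrite /pw ler_wpM2l ?powR_ge0// ler_powR//.
exact: onesqr_ge1.
Qed.

Lemma pw_shift a d x : 0 < x ->
  pw (a + 2) (d - 1) x = pw a d x * (x ^+ 2 / (1 + x ^+ 2)).
Proof.
move=> x0; rewrite -pwD//; congr (_ * _).
rewrite /pw powR_inv1 ?(ltW (onesqr_gt0 _))//.
by rewrite powR_mulrn// ltW.
Qed.

End PowerInequalities.

Section FiniteIntegral.
Context {R : realType}.
Notation mu := (@lebesgue_measure R).

(** The majorant has a finite integral over the half-line; for positivity, the minimum of [f] over
    [1, 2] is a lower bound, the interval having length 1. *)
Lemma integral_gt0_fin (f : R -> R) :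
  (forall x, 0 < x -> {for x, continuous f}) ->
  (forall x, 0 < x -> 0 < f x) ->
  (forall x, 0 < x -> f x <= (1 + x ^+ 2)^-1) ->
  exists2 S : R, 0 < S & (\int[mu]_(x in `]0%R, +oo[) (f x)%:E = S%:E)%E.
Proof.
move=> cf f0 fle.
have mf := continuous_gt0_measurable cf.
have pos (x : R) : (`]0, +oo[%classic : set R) x -> 0 < x by rewrite /= in_itv/= andbT.
have fin : (\int[mu]_(x in `]0%R, +oo[) (f x)%:E < +oo)%E.
  apply: (@le_lt_trans _ _ (\int[mu]_(x in `]0%R, +oo[) ((oneDsqr x)^-1)%:E)%E).
    apply: ge0_le_integral => //=.
    - by move=> x /pos x0; rewrite lee_fin ltW// f0.
    - exact/measurable_EFinP.
    - apply/measurable_EFinP; apply: continuous_gt0_measurable => x _.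
      exact: continuous_oneDsqrV.
    - by move=> x /pos x0; rewrite lee_fin /oneDsqr; exact: fle.
  rewrite integral_itv_obnd_cbnd ?integral0y_oneDsqr ?ltry//.
  apply/measurable_EFinP; apply: continuous_gt0_measurable => x _.
  exact: continuous_oneDsqrV.
have [c c12 cmin] : exists2 c, c \in `[1, 2]%R & forall t, t \in `[1, 2]%R -> f c <= f t.
  apply: EVT_min; first by rewrite ler1n.
  apply: continuous_in_subspaceT => x; rewrite inE/= in_itv/= => /andP[x1 _].
  by apply: cf; apply: lt_le_trans x1.
have c0 : 0 < c by move: c12; rewrite in_itv/= => /andP[c1 _]; apply: lt_le_trans c1.
have lb : ((f c)%:E <= \int[mu]_(x in `]0%R, +oo[) (f x)%:E)%E.
  have sub : (`[1, 2]%classic : set R) `<=` (`]0, +oo[%classic : set R).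
    by move=> x /=; rewrite !in_itv/= andbT => /andP[x1 _]; apply: lt_le_trans x1.
  apply: (@le_trans _ _ (\int[mu]_(x in `[1%R, 2%R]) (f c)%:E)%E).
    rewrite integral_cst//= lebesgue_measure_itv/= lte_fin ltr1n/= -EFinD.
    by rewrite -EFinM lee_fin (_ : 2 - 1 = 1) ?mulr1//; ring.
  apply: (@le_trans _ _ (\int[mu]_(x in `[1%R, 2%R]) (f x)%:E)%E).
    apply: ge0_le_integral => //=.
    - by move=> x _; rewrite lee_fin ltW// f0.
    - by apply/measurable_EFinP; apply: measurable_funS mf.

  apply: ge0_subset_integral => //=; first exact/measurable_EFinP.
  by move=> x /pos x0; rewrite lee_fin ltW// f0.
have ge0 : (0 <= \int[mu]_(x in `]0%R, +oo[) (f x)%:E)%E.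
  by apply: le_trans lb; rewrite lee_fin ltW// f0.
exists (fine (\int[mu]_(x in `]0%R, +oo[) (f x)%:E)%E); last first.
  by rewrite fineK// ge0_fin_numE.
rewrite -lte_fin fineK ?ge0_fin_numE//; apply: lt_le_trans lb.
by rewrite lte_fin f0.
Qed.

End FiniteIntegral.

(** * The operator applied to a derivative *)

Section ComplexPath.
Local Open Scope complex_scope.
Context {R : realType}.
Implicit Types (z w : R[i]).

Lemma Im_mulNi z : complex.Im z = complex.Re (z * - 'i).
Proof. by case: z => a b /=; rewrite oppr0 mulr0 mulrN mulr1 sub0r opprK. Qed.

Lemma cvg_Re (T : Type) (F : set_system T) {FF : Filter F} (g : T -> R[i]^o) (l : R[i]^o) :
  g x @[x --> F] --> l -> complex.Re (g x) @[x --> F] --> complex.Re l.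
Proof.
move=> /cvgrPdist_lt gl; apply/cvgrPdist_lt => e e0.
have e0C : 0 < e%:C :> R[i] by rewrite ltcR.
near=> t; rewrite -ltcR; apply: (@le_lt_trans _ _ `|l - g t|).
  by rewrite -raddfB; exact: normc_ge_Re.
by near: t; exact: gl.
Unshelve. all: by end_near. Qed.

Lemma cvg_Im (T : Type) (F : set_system T) {FF : Filter F} (g : T -> R[i]^o) (l : R[i]^o) :
  g x @[x --> F] --> l -> complex.Im (g x) @[x --> F] --> complex.Im l.
Proof.
move=> /cvgrPdist_lt gl; apply/cvgrPdist_lt => e e0.
have e0C : 0 < e%:C :> R[i] by rewrite ltcR.
near=> t; rewrite -ltcR; apply: (@le_lt_trans _ _ `|l - g t|).
  rewrite (_ : complex.Im l - _ = complex.Re ((l - g t) * - 'i)); last first.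
    by rewrite -Im_mulNi raddfB.
  apply: le_trans (normc_ge_Re _) _.
  by rewrite normrM normrN (normc_def 'i) /= expr0n expr1n add0r sqrtr1 mulr1.
by near: t; exact: gl.
Unshelve. all: by end_near. Qed.

Lemma cvg_real_complex : (h%:C : R[i]^o) @[h --> (0 : R)^'] --> (0 : R[i]^o)^'.
Proof.
move=> A [e /= e0 eA].
have eE : e = (complex.Re e)%:C by rewrite RRe_real// gtr0_real.
exists (complex.Re e); first by rewrite /= -ltcR -eE.
move=> h /=; rewrite sub0r normrN => he h0; apply: eA => /=.
  rewrite sub0r normrN eE normc_def /= expr0n addr0 sqrtr_sqr ltcR//.
by apply: contra h0 => /eqP[] ->.
Qed.

(** Restricting complex increments to real ones turns the derivative in direction [z] into the
    velocity along t -> t z, to which real calculus applies componentwise. *)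
Lemma cvg_path (F : R[i]^o -> R[i]^o) (dF z : R[i]^o) (t : R) :
  is_derive (t%:C * z : R[i]^o) z F dF ->
  h%:C^-1 * (F ((h + t)%:C * z) - F (t%:C * z)) @[h --> (0 : R)^'] --> dF.
Proof.
move=> [dFz <-].
have := cvg_comp _ _ cvg_real_complex dFz.
apply: cvg_trans; apply: near_eq_cvg; near=> h.
rewrite /= /GRing.scale/= rmorphD/= mulrDl.
done.
Unshelve. all: by end_near. Qed.

Lemma is_derive_Re_path (F : R[i]^o -> R[i]^o) (dF z : R[i]^o) (t : R) :
  is_derive (t%:C * z : R[i]^o) z F dF ->
  is_derive t 1 (fun s : R => complex.Re (F (s%:C * z))) (complex.Re dF).
Proof.
move=> /cvg_path /cvg_Re dRe.
have dF' : h^-1 *: (complex.Re (F ((h *: 1 + t)%:C * z)) - complex.Re (F (t%:C * z)))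
    @[h --> (0 : R)^'] --> complex.Re dF.
  apply: cvg_trans dRe; apply: near_eq_cvg; near=> h.
  rewrite -raddfB -[h *: 1]/(h * 1) mulr1 -fmorphV/=.
  by case: (_ - _) => a b /=; rewrite mul0r subr0.
split; first by apply/cvg_ex; exists (complex.Re dF).
exact/cvg_lim.
Unshelve. all: by end_near. Qed.

Lemma is_derive_Im_path (F : R[i]^o -> R[i]^o) (dF z : R[i]^o) (t : R) :
  is_derive (t%:C * z : R[i]^o) z F dF ->
  is_derive t 1 (fun s : R => complex.Im (F (s%:C * z))) (complex.Im dF).
Proof.
move=> /cvg_path /cvg_Im dIm.
have dF' : h^-1 *: (complex.Im (F ((h *: 1 + t)%:C * z)) - complex.Im (F (t%:C * z)))
    @[h --> (0 : R)^'] --> complex.Im dF.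
  apply: cvg_trans dIm; apply: near_eq_cvg; near=> h.
  rewrite -raddfB -[h *: 1]/(h * 1) mulr1 -fmorphV/=.
  by case: (_ - _) => a b /=; rewrite mul0r addr0.
split; first by apply/cvg_ex; exists (complex.Im dF).
exact/cvg_lim.
Unshelve. all: by end_near. Qed.

End ComplexPath.

Section Cesaro.
Local Open Scope complex_scope.
Context {R : realType}.
Implicit Types (H f : R[i]^o -> R[i]^o) (z w : R[i]^o) (t : R).
Notation mu := (@lebesgue_measure R).

Lemma is_derive_dir f w v df : is_derive w (1 : R[i]^o) f df ->
  is_derive w v f (v * df).
Proof.
move=> [dfw <-].
have diff : differentiable f w by exact/derivable1_diffP.
split; first exact: diff_derivable.
rewrite !deriveE// -[v in LHS]mulr1 -[v * 1]/(v *: (1 : R[i]^o)).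
by rewrite linearZ.
Qed.

Lemma Rintegral01_derive (g dg : R -> R) :
  (forall t, 0 <= t -> is_derive t 1 g (dg t)) ->
  (forall t, 0 <= t -> {for t, continuous dg}) ->
  \int[mu]_(t in `]0, 1]) dg t = g 1 - g 0.
Proof.
move=> dgE cdg.
have wdg : {within `[0, 1], continuous dg}.
  apply: continuous_in_subspaceT => t; rewrite inE/= in_itv/= => /andP[t0 _].
  exact: cdg.
have cg t : 0 <= t -> {for t, continuous g}.
  by move=> t0; apply/differentiable_continuous/derivable1_diffP; case: (dgE _ t0).
rewrite Rintegral_itv_obnd_cbnd; last first.
  apply: (@integrableS _ _ _ mu `[0, 1]) => //; first exact: subset_itv_oc_cc.
  by apply: continuous_compact_integrable => //; exact: segment_compact.
rewrite /Rintegral (@continuous_FTC2 _ dg g) //.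
- split => [t|| ].
  + by rewrite in_itv/= => /andP[/ltW t0 _]; case: (dgE _ t0).
  + by apply: cvg_at_right_filter; exact: cg.
  + by apply: cvg_at_left_filter; exact: cg.
- move=> t; rewrite in_itv/= => /andP[/ltW t0 _].
  by rewrite derive1E; case: (dgE _ t0).
Qed.

(** The path t -> H (t z) / z has velocity f (t z), so both real integrals are differences of
    endpoint values. The conditions cover the closed half-plane because the segment starts at the
    boundary point 0. *)
Lemma cesaro_primitive H f z : 0 < complex.Im z ->
  (forall w, 0 <= complex.Im w -> is_derive w (1 : R[i]^o) H (f w)) ->
  (forall w, 0 <= complex.Im w -> derivable f w (1 : R[i]^o)) ->
  H 0 = 0 -> Defs.cesaro f z = z^-1 * H z.
Proof.
move=> z0 dH df H0.
have zn0 : z != 0 by apply: contraTneq z0 => ->; rewrite ltxx.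
have tz t : 0 <= t -> 0 <= complex.Im (t%:C * z).
  by case: z z0 {zn0} => a b /= b0 t0; rewrite mul0r addr0 mulr_ge0// ltW.
pose G w : R[i]^o := z^-1 * H w.
have dG t : 0 <= t -> is_derive (t%:C * z : R[i]^o) z G (f (t%:C * z)).
  move=> t0; have -> : G = (z^-1 : R[i]) *: H by [].
  apply: is_derive_eq; first by apply: is_deriveZ; apply: is_derive_dir; exact/dH/tz.
  by rewrite /GRing.scale/= mulKf.
have cRe t : 0 <= t -> {for t, continuous (fun t => complex.Re (f (t%:C * z)))}.
  move=> t0; have /derivableP /is_derive_dir dft := df _ (tz _ t0).
  have [d _] := is_derive_Re_path (dft z).
  exact/differentiable_continuous/derivable1_diffP.
have cIm t : 0 <= t -> {for t, continuous (fun t => complex.Im (f (t%:C * z)))}.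
  move=> t0; have /derivableP /is_derive_dir dft := df _ (tz _ t0).
  have [d _] := is_derive_Im_path (dft z).
  exact/differentiable_continuous/derivable1_diffP.
rewrite /Defs.cesaro /segment_integral.
rewrite (Rintegral01_derive (fun t tge0 => is_derive_Re_path (dG t tge0)) cRe).
rewrite (Rintegral01_derive (fun t tge0 => is_derive_Im_path (dG t tge0)) cIm).
rewrite /G !mul0r H0 !mulr0 /= !subr0 mul1r.
rewrite mulKf//.
by case: (_ * _).
Qed.

End Cesaro.

Section SquaredModulus.
Local Open Scope complex_scope.
Context {R : realType}.

(** For rational test functions the squared modulus stays rational in the coordinates; the square
    root is absorbed in the exponent p / 2. *)
Definition nsq (z : R[i]) : R := complex.Re z ^+ 2 + complex.Im z ^+ 2.

Lemma nsq_ge0 z : 0 <= nsq z. Proof. by rewrite addr_ge0 ?sqr_ge0. Qed.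

Lemma normc_powR z p : ComplexField.Normc.normc z `^ p = nsq z `^ (p / 2).
Proof.
case: z => a b; rewrite /ComplexField.Normc.normc /nsq/=.
by rewrite -powR12_sqrt ?addr_ge0 ?sqr_ge0// -powRrM mulrC.
Qed.

Lemma nsqM z w : nsq (z * w) = nsq z * nsq w.
Proof. by case: z w => [a b] [c d]; rewrite /nsq/=; ring. Qed.

Lemma nsq_eq0 z : (nsq z == 0) = (z == 0).
Proof.
by case: z => a b; rewrite /nsq/= paddr_eq0 ?sqr_ge0// !sqrf_eq0 eq_complex.
Qed.

Lemma nsqV z : nsq z^-1 = (nsq z)^-1.
Proof.
have [->|z0] := eqVneq z 0.
  by rewrite invr0 /nsq/= expr0n/= addr0 invr0.
have n0 : nsq z != 0 by rewrite nsq_eq0.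
apply: (mulfI n0); rewrite -nsqM !divff// /nsq/=; first by rewrite expr1n expr0n addr0.
Qed.

Lemma nsqX z n : nsq (z ^+ n) = nsq z ^+ n.
Proof.
elim: n => [|n IH]; first by rewrite !expr0 /nsq/= expr1n expr0n addr0.
by rewrite !exprS nsqM IH.
Qed.

Lemma nsq_real (a : R) : nsq a%:C = a ^+ 2.
Proof. by rewrite /nsq/= expr0n addr0. Qed.

End SquaredModulus.

(** * Line integrals and their boundary limit *)

Section Criterion.
Local Open Scope complex_scope.
Context {R : realType}.
Notation mu := (@lebesgue_measure R).

Lemma integral_even_line (F : R[i] -> R[i]) (K : R -> R) (y p : R) : 0 < p ->
  (forall x, nsq (F (x +i* y)) = K x) -> continuous K -> (forall x, K (- x) = K x) ->
  (\int[mu]_x (ComplexField.Normc.normc (F (x +i* y)) `^ p)%:E =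
   2%:E * \int[mu]_(x in `]0%R, +oo[) (K x `^ (p / 2))%:E)%E.
Proof.
move=> p0 FK cK evK.
have K0 x : 0 <= K x by rewrite -FK nsq_ge0.
have cKp : continuous (fun x => K x `^ (p / 2)).
  by move=> x; apply: cvg_powR_ge0; [rewrite divr_gt0| | |exact: cK].
under eq_integral do rewrite normc_powR FK.
rewrite (@ge0_symfun_integralT R (fun x => K x `^ (p / 2)))//; first last.
- by move=> x /=; rewrite evK.
- by move=> x; exact: powR_ge0.
rewrite -set_itvcy integral_itv_obnd_cbnd//.
apply/measurable_EFinP; apply: measurable_funTS.
exact: continuous_measurable_fun.
Qed.

(** Fatou's lemma along y = 1 / (n + 1): the boundary integral is at most a lower limit of line
    integrals, each bounded by the supremum. *)
Lemma fatou_boundary (G : R -> R -> R) :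
  (forall x y, 0 <= G x y) ->
  (forall y, 0 < y -> measurable_fun (`]0, +oo[ : set R) (G^~ y)) ->
  (forall x, 0 < x -> G x y @[y --> 0^'+] --> G x 0) ->
  (\int[mu]_(x in `]0%R, +oo[) (G x 0)%:E <=
   ereal_sup [set \int[mu]_(x in `]0%R, +oo[) (G x y)%:E | y in [set y | (0 < y)%R]])%E.
Proof.
move=> G0 mG cG.
pose f n x : \bar R := (G x n.+1%:R^-1)%:E.
have mf n : measurable_fun (`]0%R, +oo[ : set R) (f n).
  by apply/measurable_EFinP; apply: mG; rewrite invr_gt0.
have fat := @fatou _ _ R mu (`]0%R, +oo[ : set R) (measurable_itv _) f mf
  (fun n x _ => (G0 x _ : (0 <= (G x n.+1%:R^-1)%:E)%E)).
apply: (@le_trans _ _ (\int[mu]_(x in `]0%R, +oo[) limn_einf (f ^~ x))%E).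
  rewrite le_eqVlt; apply/orP; left; apply/eqP; apply: eq_integral => x.
  rewrite inE/= in_itv/= andbT => x0.
  suff /cvg_limn_einf_sup[-> //] : f n x @[n --> \oo] --> (G x 0)%:E.
  apply: cvg_EFin; first exact: nearW.
  move/cvg_at_rightP : (cG _ x0); apply; split => [n|]; first by rewrite invr_gt0.
  exact: (@cvg_harmonic R).
apply: (le_trans fat); rewrite limn_einf_lim.
apply: lime_le; first exact: is_cvg_einfs.
apply: nearW => n; apply: (@le_trans _ _ (\int[mu]_(x in `]0%R, +oo[) f n x)%E).
  by apply: ereal_inf_lbound; exists n => //=.
by apply: ereal_sup_ubound; exists n.+1%:R^-1 => //=; rewrite invr_gt0.
Qed.

End Criterion.

(** * From a primitive to a lower bound for the operator norm *)

Section OperatorNorm.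
Local Open Scope complex_scope.
Context {R : realType}.
Notation mu := (@lebesgue_measure R).
Implicit Types (p S rho x y : R) (w : R[i]^o).

(** [F] and [G] are the squared moduli of f and V f. The test function must have norm at most 1, so
    f is controlled by [S] on every horizontal line, whereas V f is measured on the boundary alone,
    where Fatou's lemma applies. *)
Lemma operator_norm_cesaro_V_ge p (H f : R[i]^o -> R[i]^o) (F G : R -> R -> R) S rho :
  1 < p -> 0 < S ->
  (forall w, 0 <= complex.Im w -> is_derive w (1 : R[i]^o) H (f w)) ->
  (forall w, 0 <= complex.Im w -> derivable f w (1 : R[i]^o)) ->
  H 0 = 0 ->
  (forall x y, 0 < y -> nsq (f (x +i* y)) = F x y) ->
  (forall x y, 0 < y ->
    nsq ((2 * ((p - 1) / p))%:C * ((x +i* y)^-1 * H (x +i* y)) - f (x +i* y)) = G x y) ->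
  (forall y, 0 < y -> continuous (F^~ y)) -> (forall x y, F (- x) y = F x y) ->
  (forall y, 0 < y -> continuous (G^~ y)) -> (forall x y, G (- x) y = G x y) ->
  (forall x y, 0 <= G x y) ->
  (forall x, 0 < x -> G x y @[y --> 0^'+] --> G x 0) ->
  (forall y, 0 < y -> (\int[mu]_(x in `]0%R, +oo[) (F x y `^ (p / 2))%:E <= S%:E)%E) ->
  ((rho * S)%:E <= \int[mu]_(x in `]0%R, +oo[) (G x 0 `^ (p / 2))%:E)%E ->
  (rho%:E <= operator_norm p (cesaro_V p) `^ p)%E.
Proof.
move=> p1 S0 dH df H0 Ff Gg cF evF cG evG Gge0 cG0 IF IG.
have p0 : 0 < p by exact: lt_trans p1.
have pn0 : p != 0 by rewrite gt_eqF.
have p20 : 0 < p / 2 by rewrite divr_gt0.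
have pi0 := pi_gt0 R.
(* Since a^p = pi / S, the factor 1 / (2 pi) of the norm and the 2 from folding the line at x = 0
   combine to 1 / S. *)
pose a := (pi / S) `^ p^-1.
have a0 : 0 < a by rewrite powR_gt0// divr_gt0.
have ap : (a ^+ 2) `^ (p / 2) = pi / S.
  rewrite -powR_mulrn ?(ltW a0)// -powRrM mulrC divfK// -powRrM mulVf// powRr1//.
  by rewrite divr_ge0// ltW.
pose fa w : R[i]^o := a%:C * f w.
pose Ha w : R[i]^o := a%:C * H w.
have dHa w : 0 <= complex.Im w -> is_derive w (1 : R[i]^o) Ha (fa w).
  by move=> w0; have := dH _ w0 => dHw; exact: (is_deriveZ (a%:C)).
have dfa w : 0 <= complex.Im w -> derivable fa w (1 : R[i]^o).
  by move=> w0; apply: (derivableZ (k := a%:C)); exact: df.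
have Ha0 : Ha 0 = 0 by rewrite /Ha H0 mulr0.
have VE x y : 0 < y -> cesaro_V p fa (x +i* y) = a%:C *
    ((2 * ((p - 1) / p))%:C * ((x +i* y)^-1 * H (x +i* y)) - f (x +i* y)).
  move=> y0; rewrite /cesaro_V (@cesaro_primitive R Ha fa (x +i* y) y0 dHa dfa Ha0) /fa /Ha.
  by rewrite mulrBr (mulrCA (x +i* y)^-1) (mulrCA _ a%:C).
have scaled (h : R[i] -> R[i]) (K : R -> R -> R) y : 0 < y ->
    (forall x, nsq (h (x +i* y)) = a ^+ 2 * K x y) -> (forall x, 0 <= K x y) ->
    continuous (K^~ y) -> (forall x, K (- x) y = K x y) ->
    (((2 * pi)^-1)%:E * \int[mu]_x (ComplexField.Normc.normc (h (x +i* y)) `^ p)%:E =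
     (S^-1)%:E * \int[mu]_(x in `]0%R, +oo[) (K x y `^ (p / 2))%:E)%E.
  move=> y0 hK K0 cK evK.
  rewrite (integral_even_line (K := fun x => a ^+ 2 * K x y))//; first last.
  - by move=> x; rewrite evK.
  - by move=> x; apply: cvgM; [exact: cvg_cst|exact: cK].
  under eq_integral do rewrite powRM ?sqr_ge0// ap EFinM.
  rewrite ge0_integralZl_EFin//; first last.
  - by rewrite divr_ge0// ltW.
  - apply/measurable_EFinP; apply: continuous_gt0_measurable => x _.
    by apply: cvg_powR_ge0 => //; exact: cK.
  - by move=> x _; rewrite lee_fin powR_ge0.
  rewrite !muleA -!EFinM; congr (_%:E * _)%E.
  by move: pi pi0 => q q0; field; rewrite !gt_eqF.
have nF y : 0 < y -> forall x, nsq (fa (x +i* y)) = a ^+ 2 * F x y.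
  by move=> y0 x; rewrite nsqM nsq_real Ff.
have nG y : 0 < y -> forall x, nsq (cesaro_V p fa (x +i* y)) = a ^+ 2 * G x y.
  by move=> y0 x; rewrite VE// nsqM nsq_real Gg.
have Fge0 x y : 0 < y -> 0 <= F x y by move=> y0; rewrite -Ff// nsq_ge0.
have norm_fa : (hardy_norm p fa <= 1)%E.
  rewrite /hardy_norm -[leRHS](@poweR1r R p^-1).
  have sup1 : (ereal_sup [set ((2 * pi)^-1)%:E *
      \int[mu]_x (ComplexField.Normc.normc (fa (x +i* y)) `^ p)%:E
      | y in [set y : R | (0 < y)%R]] <= 1)%E.
    apply: ge_ereal_sup => _ [y /= y0 <-].
    rewrite (scaled _ F)//; last 3 first.
    - exact: nF.
    - by move=> x; exact: Fge0.
    - exact: cF.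
    apply: (@le_trans _ _ ((S^-1)%:E * S%:E)%E).
      by apply: lee_wpmul2l; [rewrite lee_fin invr_ge0 ltW|exact: IF].
    by rewrite -EFinM mulVf ?gt_eqF.
  apply: gt0_ler_poweR => //; [by rewrite invr_ge0 ltW| | ].
  - rewrite in_itv/= leey andbT.
    (* Any single line, here y = 1, shows that the supremum is nonnegative, as monotonicity of
       powers requires. *)
    apply: (le_trans _ (ereal_sup_ubound _)); last first.
      by exists 1 => //=; reflexivity.
    apply: mule_ge0; first by rewrite lee_fin invr_ge0 mulr_ge0// ltW.
    by apply: integral_ge0 => x _; rewrite lee_fin powR_ge0.
  - by rewrite in_itv/= leey andbT.
have fa_space : hardy_space p fa.
  split; last by apply: le_lt_trans norm_fa _; rewrite ltry.
  by move=> z /= z0; apply: dfa; exact: ltW.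
have opge : (hardy_norm p (cesaro_V p fa) <= operator_norm p (cesaro_V p))%E.
  by apply: ereal_sup_ubound; exists fa.
have sup_ge : (rho%:E <= ereal_sup [set ((2 * pi)^-1)%:E *
      \int[mu]_x (ComplexField.Normc.normc (cesaro_V p fa (x +i* y)) `^ p)%:E
      | y in [set y : R | (0 < y)%R]])%E.
  set T := ereal_sup _.
  suff ST : ((rho * S)%:E <= S%:E * T)%E.
    have SV : (0 <= (S^-1)%:E)%E by rewrite lee_fin invr_ge0 ltW.
    have := lee_wpmul2l SV ST.
    by rewrite muleA -!EFinM mulVf ?gt_eqF// mul1e mulrC mulfK ?gt_eqF.
  apply: (le_trans IG); apply: (le_trans (@fatou_boundary R (fun x y => G x y `^ (p / 2)) _ _ _)).
  - by move=> x y; exact: powR_ge0.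
  - move=> y y0; apply: continuous_gt0_measurable => x _.
    by apply: cvg_powR_ge0 => //; exact: cG.
  - by move=> x x0; apply: cvg_powR_ge0 => //; exact: cG0.
  apply: ge_ereal_sup => _ [y /= y0 <-].
  have -> : (\int[mu]_(x in `]0%R, +oo[) (G x y `^ (p / 2))%:E = S%:E * (((2 * pi)^-1)%:E *
      \int[mu]_x (ComplexField.Normc.normc (cesaro_V p fa (x +i* y)) `^ p)%:E))%E.
    rewrite (scaled _ G)//; last 2 first.
    - exact: nG.
    - exact: cG.
    by rewrite muleA -EFinM divff ?gt_eqF// mul1e.
  apply: lee_wpmul2l; first by rewrite lee_fin ltW.
  by apply: ereal_sup_ubound; exists y.
have T0 : (0 <= hardy_norm p (cesaro_V p fa))%E by exact: poweR_ge0.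
apply: (@le_trans _ _ (hardy_norm p (cesaro_V p fa) `^ p)%E); last first.
  apply: gt0_ler_poweR => //; first exact: ltW.
  - by rewrite in_itv/= T0 leey.
  - by rewrite in_itv/= leey andbT (le_trans T0).
rewrite /hardy_norm -poweRrM mulVf// poweRe1//.
apply: (le_trans _ (ereal_sup_ubound _)); last first.
  by exists 1 => //=; reflexivity.
apply: mule_ge0; first by rewrite lee_fin invr_ge0 mulr_ge0// ltW.
by apply: integral_ge0 => x _; rewrite lee_fin powR_ge0.
Qed.

End OperatorNorm.

Section RationalFunctions.
Local Open Scope complex_scope.
Context {R : realType}.
Implicit Types (w : R[i]^o) (x y : R).

(** The pole -i lies off the closed half-plane, so test functions built from this are analytic up to
    the boundary. *)
Definition invi w : R[i]^o := (w + 'i)^-1.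

Lemma addi_neq0 w : 0 <= complex.Im w -> w + 'i != 0.
Proof.
case: w => a b /= b0; rewrite eq_complex negb_and /= orbC gt_eqF//.
by rewrite ltr_wpDl.
Qed.

Lemma inviK w : 0 <= complex.Im w -> invi w * (w + 'i) = 1.
Proof. by move=> /addi_neq0 w0; rewrite /invi mulVf. Qed.

Lemma is_derive_invi w : 0 <= complex.Im w ->
  is_derive w (1 : R[i]^o) invi (- invi w ^+ 2).
Proof.
move=> w0.
pose s : R[i]^o -> R[i]^o := id + cst 'i.
have ds := is_deriveD (is_derive_id w (1 : R[i]^o)) (is_derive_cst ('i : R[i]^o) w (1 : R[i]^o)).
have sn0 : s w != 0 by exact: addi_neq0.
have [d1 d2] := ds.
split; first exact: (derivableV sn0 d1).
rewrite [LHS](deriveV sn0 d1) [X in _ *: X]d2.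
by rewrite addr0 /GRing.scale/= mulr1 /invi exprVn.
Qed.

Lemma nsq_invi x y : nsq (invi (x +i* y)) = (x ^+ 2 + (1 + y) ^+ 2)^-1.
Proof. by rewrite /invi nsqV /nsq/= addr0 [y + 1]addrC. Qed.

Lemma real_shift_gt0 x y : 0 < y -> 0 < x ^+ 2 + (1 + y) ^+ 2.
Proof. by move=> y0; rewrite ltr_wpDl ?sqr_ge0// exprn_gt0// addr_gt0. Qed.

End RationalFunctions.

(** * Exponents above 2 *)

Section LargeExponent.
Context {R : realType}.
Notation mu := (@lebesgue_measure R).
Implicit Types (b k e p q t x : R).

(** Bernoulli's bound for (1/t)^(q - 1) gives t^q >= t^2 / D with D = 1 + (2 - q) (t - 1), and t^2 /
    D = 1 + q (t - 1) + (q - 1)^2 (t - 1)^2 / D exactly. As D lies between 1 and t, it is at most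
    25/4, the largest value of (b + 2)^2 when p <= 4. *)
Lemma powR_quadratic_le2 q t : 1 <= q <= 2 -> 0 < t <= 25 / 4 ->
  1 + q * (t - 1) + (q - 1) ^+ 2 * (4 / 25) * (t - 1) ^+ 2 <= t `^ q.
Proof.
move=> /andP[q1 q2] /andP[t0 t254].
have th01 : 0 <= q - 1 <= 1 by apply/andP; split; lra.
have D0 : 0 < 1 + (q - 1) * (t^-1 - 1).
  have tV : 0 < t^-1 by rewrite invr_gt0.
  by have [q2'|q2'] := ltP q 2; nra.
have tq : t ^+ 2 / (t + (q - 1) * (1 - t)) <= t `^ q.
  have := powR_bernoulli_le th01 (ltW (_ : 0 < t^-1)).
  rewrite invr_gt0 t0 => /(_ isT) H.
  have tE : t `^ q = t / (t^-1) `^ (q - 1).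
    rewrite -[t^-1]powR_inv1 ?(ltW t0)// -powRrM mulN1r powRN invrK.
    rewrite -[t in X in _ = X * _]powRr1 ?(ltW t0)// -powRD ?(gt_eqF t0) ?implybT//.
    by congr (_ `^ _); ring.
  have -> : t ^+ 2 / (t + (q - 1) * (1 - t)) = t / (1 + (q - 1) * (t^-1 - 1)).
    have tn0 : t != 0 by rewrite gt_eqF.
    have -> : t + (q - 1) * (1 - t) = t * (1 + (q - 1) * (t^-1 - 1)) by field.
    by rewrite expr2 -mulf_div divff// mul1r.
  rewrite tE ler_pM2l// lef_pV2 ?posrE// powR_gt0// invr_gt0//.
apply: le_trans tq.
have D1 : 0 < t + (q - 1) * (1 - t) by nra.
rewrite ler_pdivlMr//.
have D2 : t + (q - 1) * (1 - t) <= 25 / 4 by nra.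
have : (q - 1) ^+ 2 * (4 / 25) * (t - 1) ^+ 2 * (t + (q - 1) * (1 - t)) <=
    (q - 1) ^+ 2 * (t - 1) ^+ 2.
  move: D2; set D := t + (q - 1) * (1 - t) => D2.
  have D3 : 4 / 25 * D <= 1 by move: D D2 {D1} => D D2; lra.
  have -> : (q - 1) ^+ 2 * (4 / 25) * (t - 1) ^+ 2 * D =
      (q - 1) ^+ 2 * (t - 1) ^+ 2 * (4 / 25 * D) by ring.
  by rewrite ler_piMr// mulr_ge0 ?sqr_ge0.
by nra.
Qed.

(** For t >= 1, square Bernoulli's inequality with exponent q / 2. For t < 1 its linear side may be
    negative and squaring can fail; there the subtracted constant makes the quadratic correction
    nonpositive, and Bernoulli with exponent q suffices. *)
Lemma powR_quadratic_ge2 q t b : 2 <= q -> 0 <= b <= 1 -> b ^+ 2 <= t ->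
  1 + q * (t - 1) + q ^+ 2 / 4 * ((t - 1) ^+ 2 - (1 - b ^+ 2) ^+ 2) <= t `^ q.
Proof.
move=> q2 /andP[b0 b1] bt.
have t0 : 0 <= t by apply: le_trans bt; rewrite sqr_ge0.
have [t1|t1] := leP 1 t.
  have h2 : 1 <= q / 2 by lra.
  have h := powR_bernoulli_ge h2 t0.
  have -> : t `^ q = (t `^ (q / 2)) ^+ 2.
    by rewrite -powR_mulrn ?powR_ge0// -powRrM divfK.
  have : (1 + q / 2 * (t - 1)) ^+ 2 <= (t `^ (q / 2)) ^+ 2.
    by rewrite ler_sqr ?nnegrE ?powR_ge0//; nra.
  have : 0 <= q ^+ 2 / 4 * (1 - b ^+ 2) ^+ 2 by rewrite mulr_ge0 ?sqr_ge0// divr_ge0 ?sqr_ge0.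
  by nra.
have q1 : 1 <= q by lra.
apply: le_trans (powR_bernoulli_ge q1 t0).
have : (t - 1) ^+ 2 <= (1 - b ^+ 2) ^+ 2 by nra.
have : 0 <= q ^+ 2 / 4 by rewrite divr_ge0 ?sqr_ge0.
by nra.
Qed.

(* |Vf|^2 / |f|^2 on the real axis for f = (i - z) / (z + i)^3.  Its mean for
   the weight |f|^p = (1 + x^2)^(-p) is 1, whatever p. *)
Definition wt b x : R := ((b + 2) ^+ 2 * x ^+ 2 + b ^+ 2) / (1 + x ^+ 2).

(* With t = wt b and u = x^2 / (1 + x^2), the quadratic minorant of t^(p/2) is
   an affine image of u and u^2; subtracting from it the derivative of F, whose
   integral vanishes, leaves the constant 1 + k (V - e), V being the variance
   of t. *)
Lemma le_integral_weighted p k e K : 2 < p ->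
  let b := 1 - 2 / p in
  let V := 16 * (p - 1) ^+ 2 * (2 * p - 1) / (p ^+ 4 * (p + 1)) in
  0 <= 1 + k * (V - e) ->
  (forall t, b ^+ 2 <= t <= (b + 2) ^+ 2 ->
    1 + p / 2 * (t - 1) + k * ((t - 1) ^+ 2 - e) <= t `^ (p / 2)) ->
  (\int[mu]_(x in `]0%R, +oo[) (pw 0 (- p) x)%:E = K%:E)%E ->
  (((1 + k * (V - e)) * K)%:E <=
   \int[mu]_(x in `]0%R, +oo[) (pw 0 (- p) x * wt b x `^ (p / 2))%:E)%E.
Proof.
move=> p2 b V rho0 Hk KE.
set rho := 1 + k * (V - e).
have p0 : 0 < p by lra.
(* [be] is determined by the coefficient of u^2, then [al] by that of u; the constant terms agree
   because [V] is the variance. *)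
pose be := - 8 * k * (1 + b) ^+ 2 / (p + 1).
pose al := - (2 * p * (1 + b) - 16 * k * (1 + b) ^+ 2 / p - 3 * be) / (2 * p).
pose F x := al * pw 1 (- p) x + be * pw 3 (- p - 1) x.
pose dF x := al * (1 * pw (1 - 1) (- p) x + 2 * (- p) * pw (1 + 1) (- p - 1) x) +
  be * (3 * pw (3 - 1) (- p - 1) x + 2 * (- p - 1) * pw (3 + 1) (- p - 1 - 1) x).
have dFE x : 0 < x -> is_derive x (1 : R) F (dF x).
  move=> x0; have h1 := is_deriveZ al (is_derive_pw 1 (- p) x0).
  have h2 := is_deriveZ be (is_derive_pw 3 (- p - 1) x0).
  exact: (is_deriveD h1 h2).
have -> : ((rho * K)%:E = \int[mu]_(x in `]0%R, +oo[) (rho * pw 0 (- p) x)%:E)%E.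
  under eq_integral do rewrite EFinM.
  rewrite ge0_integralZl_EFin//; first by rewrite KE.
  - by move=> x _; rewrite lee_fin pw_ge0.
  - by apply/measurable_EFinP; apply: continuous_gt0_measurable => x; exact: continuous_pw.
have cwt x : {for x, continuous (wt b)}.
  apply: cvgM.
    apply: cvgD; last exact: cvg_cst.
    by apply: cvgM; [exact: cvg_cst|exact: exprn_continuous].
  apply: cvgV; first by rewrite gt_eqF ?onesqr_gt0.
  by apply: cvgD; [exact: cvg_cst|exact: exprn_continuous].
have wt0 x : 0 <= wt b x.
  apply: divr_ge0; last exact/ltW/onesqr_gt0.
  by apply: addr_ge0; [apply: mulr_ge0; exact: sqr_ge0|exact: sqr_ge0].
have [F0 Foo] : F x @[x --> 0^'+] --> (0 : R) /\ F x @[x --> +oo%R] --> (0 : R).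
  apply: (@cvg_dominated_pw _ F (`|al| + `|be|) 1) => // x x0.
  apply: le_trans (ler_normD _ _) _; rewrite mulrDl.
  rewrite (normrM al) (normrM be) !(ger0_norm (pw_ge0 _ _ _)).
  have h1 : pw 1 (- p) x <= pw 1 (- 1) x by apply: ler_pw; lra.
  apply: lerD; rewrite ler_wpM2l// ?normr_ge0//.
  apply: le_trans h1.
  have -> : pw 3 (- p - 1) x = pw (1 + 2) (- p - 1) x by congr (pw _ _ _); ring.
  rewrite pw_shift// ler_piMr ?pw_ge0// ler_pdivrMr ?onesqr_gt0// mul1r lerDr//.
apply: (@le_integral_derive _ F dF) => //.
- by move=> x x0; rewrite mulr_ge0 ?pw_ge0 ?powR_ge0.
- by move=> x x0; rewrite mulr_ge0 ?pw_ge0.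
- move=> x x0; apply: cvgM; first exact: continuous_pw.
  by apply: cvg_powR_ge0 => //; [rewrite divr_gt0|exact: cwt].
- by move=> x x0; apply: cvgM; [exact: cvg_cst|exact: continuous_pw].
- move=> x x0; apply: cvgD; (apply: cvgM; first exact: cvg_cst);
    by apply: cvgD; (apply: cvgM; first exact: cvg_cst); exact: continuous_pw.
- move=> x x0.
  pose u := x ^+ 2 / (1 + x ^+ 2).
  have s1 := onesqr_gt0 x.
  have u0 : 0 <= u by rewrite divr_ge0 ?sqr_ge0// ltW.
  have u1 : u <= 1 by rewrite ler_pdivrMr// mul1r lerDr.
  have tE : wt b x = b ^+ 2 + 4 * (1 + b) * u.
    by rewrite /wt /u; field; rewrite gt_eqF.
  have dFu : dF x = pw 0 (- p) x * (al * (1 - 2 * p * u) + be * (3 * u - 2 * (p + 1) * u ^+ 2)).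
    have e1 : pw (1 - 1) (- p) x = pw 0 (- p) x by congr (pw _ _ _); ring.
    have e2 : pw (1 + 1) (- p - 1) x = pw 0 (- p) x * u.
      by rewrite -pw_shift//; congr (pw _ _ _); ring.
    have e3 : pw (3 - 1) (- p - 1) x = pw 0 (- p) x * u.
      by rewrite -pw_shift//; congr (pw _ _ _); ring.
    have e4 : pw (3 + 1) (- p - 1 - 1) x = pw 0 (- p) x * u * u.
      by rewrite -!pw_shift//; congr (pw _ _ _); ring.
    by rewrite /dF e1 e2 e3 e4; ring.
  rewrite dFu [rho * _]mulrC -mulrDr ler_wpM2l ?pw_ge0//.
  have b0 : 0 <= b by rewrite /b subr_ge0 ler_pdivrMr// mul1r ltW.
  have tint : b ^+ 2 <= wt b x <= (b + 2) ^+ 2.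
    by rewrite tE; apply/andP; split; nra.
  apply: le_trans (Hk _ tint); rewrite tE le_eqVlt; apply/orP; left; apply/eqP.
  rewrite /rho /al /be /V /b; field.
  by rewrite gt_eqF//= gt_eqF//; lra.
Qed.

End LargeExponent.

(** * The test function z / (z + i)^2 *)

Section LargeExponentTestFunction.
Local Open Scope complex_scope.
Context {R : realType}.
Notation mu := (@lebesgue_measure R).
Implicit Types (w : R[i]^o) (p x y : R).

Let H w : R[i]^o := w * invi w ^+ 2.
Let f w : R[i]^o := ('i - w) * invi w ^+ 3.

Let dH w : 0 <= complex.Im w -> is_derive w (1 : R[i]^o) H (f w).
Proof.
move=> w0; have dv := is_derive_invi w0.
apply: (is_derive_eq (is_deriveM (is_derive_id w (1 : R[i]^o)) (is_deriveX 2 dv))).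
have -> : (invi ^+ 2) w = invi w ^+ 3 * (w + 'i).
  by rewrite [in RHS]exprSr -mulrA inviK// mulr1.
by rewrite /f /GRing.scale/=; ring.
Qed.

Let df w : 0 <= complex.Im w -> derivable f w (1 : R[i]^o).
Proof.
move=> w0; have dv := is_derive_invi w0.
have ds := is_deriveB (is_derive_cst ('i : R[i]^o) w (1 : R[i]^o)) (is_derive_id w (1 : R[i]^o)).
by have [] := is_deriveM ds (is_deriveX 3 dv).
Qed.

Lemma operator_norm_ge_large p k e : 2 < p ->
  let b := 1 - 2 / p in
  let V := 16 * (p - 1) ^+ 2 * (2 * p - 1) / (p ^+ 4 * (p + 1)) in
  0 <= 1 + k * (V - e) ->
  (forall t, b ^+ 2 <= t <= (b + 2) ^+ 2 ->
    1 + p / 2 * (t - 1) + k * ((t - 1) ^+ 2 - e) <= t `^ (p / 2)) ->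
  ((1 + k * (V - e))%:E <= operator_norm p (cesaro_V p) `^ p)%E.
Proof.
move=> p2 b V rho0 Hk.
have p1 : 1 < p by apply: lt_trans p2; rewrite ltr1n.
have p0 : 0 < p by lra.
have [S S0 SE] : exists2 S : R, 0 < S & (\int[mu]_(x in `]0%R, +oo[) (pw 0 (- p) x)%:E = S%:E)%E.
  apply: integral_gt0_fin => x x0; first exact: continuous_pw.
  - exact: pw_gt0.
  - rewrite -powR_inv1 ?(ltW (onesqr_gt0 _))// /pw powRr0 mul1r.
    by rewrite ler_powR ?onesqr_ge1//; lra.
pose F x y := (x ^+ 2 + (1 - y) ^+ 2) * ((x ^+ 2 + (1 + y) ^+ 2)^-1) ^+ 3.
(* The coefficient 2 (p - 1) / p of the Cesàro part is 1 + b, so V f = ((b + 2) z + b i) / (z +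
   i)^3. *)
pose G x y := ((b + 2) ^+ 2 * x ^+ 2 + ((b + 2) * y + b) ^+ 2) *
  ((x ^+ 2 + (1 + y) ^+ 2)^-1) ^+ 3.
have cinv y : 0 < y -> continuous (fun x : R => ((x ^+ 2 + (1 + y) ^+ 2)^-1) ^+ 3).
  move=> y0 x; apply: cvg_exp; apply: cvgV; first by rewrite gt_eqF// real_shift_gt0.
  by apply: cvgD; [exact: exprn_continuous|exact: cvg_cst].
have cF y : 0 < y -> continuous (F^~ y).
  move=> y0 x; apply: cvgM; last exact: cinv.
  by apply: cvgD; [exact: exprn_continuous|exact: cvg_cst].
have F0 x y : 0 <= F x y.
  rewrite /F mulr_ge0 ?addr_ge0 ?sqr_ge0//.
  by rewrite exprn_ge0// invr_ge0 addr_ge0 ?sqr_ge0.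
have p20 : 0 < p / 2 by rewrite divr_gt0.
have invsq_powR x : (((1 + x ^+ 2)^-1) ^+ 2) `^ (p / 2) = pw 0 (- p) x.
  rewrite exprVn -(powR_invn 2 (ltW (onesqr_gt0 x))) -powRrM /pw powRr0 mul1r.
  by congr (_ `^ _); field.
apply: (@operator_norm_cesaro_V_ge _ p H f F G S) => //.
- by rewrite /H mul0r.
- by move=> x y y0; rewrite /f nsqM nsqX nsq_invi /nsq/= sub0r sqrrN.
- move=> x y y0.
  have wn0 : x +i* y != 0 by rewrite eq_complex negb_and orbC /= gt_eqF.
  have vn0 : x +i* y + 'i != 0 by apply: addi_neq0; exact: ltW.
  rewrite (_ : _ - _ = ((b + 2) * x +i* ((b + 2) * y + b)) * invi (x +i* y) ^+ 3); last first.
    have -> : (b + 2) * x +i* ((b + 2) * y + b) = (2 * ((p - 1) / p))%:C * (x +i* y + 'i) -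
        ('i - (x +i* y)).
      by apply/eqP; rewrite eq_complex /= /b; apply/andP; split; apply/eqP; field; lra.
    rewrite /H /f mulKf// [RHS]mulrBl; congr (_ - _).
    have vK := @inviK R (x +i* y) (ltW y0).
    rewrite -[RHS]mulrA; congr (_ * _).
    by rewrite [in RHS]exprS mulrA [X in _ = X * _]mulrC vK mul1r.
  by rewrite nsqM nsqX nsq_invi /nsq/= exprMn.
- by move=> x y; rewrite /F sqrrN.
- move=> y y0 x; apply: cvgM; last exact: cinv.
  apply: cvgD; last exact: cvg_cst.
  by apply: cvgM; [exact: cvg_cst|exact: exprn_continuous].
- by move=> x y; rewrite /G sqrrN.
- move=> x y; apply: mulr_ge0.
    by apply: addr_ge0; [apply: mulr_ge0; exact: sqr_ge0|exact: sqr_ge0].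
  by rewrite exprn_ge0// invr_ge0 addr_ge0 ?sqr_ge0.
- move=> x x0; rewrite /G; apply: cvg_at_right_filter; apply: cvgM.
    apply: cvgD; first exact: cvg_cst.
    apply: cvg_exp; apply: cvgD; last exact: cvg_cst.
    by apply: cvgM; [exact: cvg_cst|exact: cvg_id].
  apply: cvg_exp; apply: cvgV; first by rewrite addr0 expr1n gt_eqF// addrC onesqr_gt0.
  apply: cvgD; first exact: cvg_cst.
  by apply: cvg_exp; apply: cvgD; [exact: cvg_cst|exact: cvg_id].
- move=> y y0; rewrite -SE; apply: ge0_le_integral => //=.
  + by move=> x _; rewrite lee_fin powR_ge0.
  + apply/measurable_EFinP; apply: continuous_gt0_measurable => x _.
    by apply: cvg_powR_ge0 => //; exact: cF.
  + by apply/measurable_EFinP; apply: continuous_gt0_measurable => x; exact: continuous_pw.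
  + move=> x; rewrite in_itv/= andbT => x0; rewrite lee_fin -invsq_powR.
    apply: ge0_ler_powR; rewrite ?nnegrE ?exprn_ge0 ?invr_ge0 ?(ltW p20)//.
      exact/ltW/onesqr_gt0.
    have B0 := @real_shift_gt0 _ x y y0.
    (* (1 - y)^2 <= (1 + y)^2 cancels one factor and the rest decreases in y, so the boundary value
       dominates pointwise. *)
    apply: (@le_trans _ _ (((x ^+ 2 + (1 + y) ^+ 2)^-1) ^+ 2)).
      rewrite /F [X in _ * X]exprS mulrA ler_piMl ?exprn_ge0 ?invr_ge0 ?(ltW B0)//.
      by rewrite ler_pdivrMr// mul1r lerD2l; nra.
    rewrite ler_sqr ?nnegrE ?invr_ge0 ?(ltW B0) ?(ltW (onesqr_gt0 _))//.
    by rewrite lef_pV2 ?posrE ?onesqr_gt0//; nra.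
- apply: (le_trans (le_integral_weighted p2 rho0 Hk SE)).
  rewrite le_eqVlt; apply/orP; left; apply/eqP; apply: eq_integral => x _.
  rewrite -invsq_powR -powRM ?sqr_ge0//.
  + congr (_ `^ _)%:E; rewrite /G /wt mulr0 add0r addr0 expr1n [x ^+ 2 + 1]addrC.
    by rewrite -/b; move: (b) (1 + x ^+ 2) => c q; ring.
  + apply: divr_ge0; last exact/ltW/onesqr_gt0.
    by apply: addr_ge0; [apply: mulr_ge0; exact: sqr_ge0|exact: sqr_ge0].
Qed.

End LargeExponentTestFunction.

(** * Comparison with exp R above 2 *)

Section LargeExponentBound.
Context {R : realType}.
Implicit Types (p s x : R).

Lemma expR_le_inv x : x < 1 -> expR x <= (1 - x)^-1.
Proof.
move=> x1; rewrite -[x in expR x]opprK expRN lef_pV2 ?posrE ?expR_gt0 ?subr_gt0//.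
exact: expR_ge1Dx.
Qed.

Lemma kappa_gt1 : 1 < kappa :> R.
Proof. by rewrite /kappa ltrDl invr_gt0 sqrtr_gt0. Qed.

(** kappa > 1 makes the cubic denominator at least 2. This serves p <= 4; for larger p, where s^2 /
    48 grows without bound, the constant bound 1/24 replaces it. *)
Lemma Rfun_le_sq s : 0 <= s -> Rfun s <= s ^+ 2 / 48.
Proof.
move=> s0; have k1 := kappa_gt1; set k := kappa in k1 *.
have D : 2 <= k * (k + s) * (2 * k + s).
  have h1 : 1 <= k * (k + s) by nra.
  by nra.
rewrite /Rfun -/k (_ : s ^+ 2 / 48 = 24^-1 * (s ^+ 2 / 2)); last by field.
rewrite ler_pM2l ?invr_gt0// ler_wpM2l ?sqr_ge0// lef_pV2 ?posrE//; lra.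
Qed.

Lemma Rfun_le_inv24 s : 0 <= s -> Rfun s <= 24^-1.
Proof.
move=> s0; have k1 := kappa_gt1; set k := kappa in k1 *.
have h1 : 1 + s <= k * (k + s) by nra.
have D : s ^+ 2 <= k * (k + s) * (2 * k + s) by nra.
have D0 : 0 < k * (k + s) * (2 * k + s) by nra.
by rewrite /Rfun -/k ger_pMr ?invr_gt0// ler_pdivrMr// mul1r.
Qed.

Lemma operator_norm_gt_large p : 2 < p ->
  ((expR (Rfun (p - 2)))%:E < operator_norm p (cesaro_V p) `^ p)%E.
Proof.
move=> p2; pose b := 1 - 2 / p.
have p0 : 0 < p by lra.
have pn0 : p != 0 by rewrite gt_eqF.
have p1n0 : p + 1 != 0 by rewrite gt_eqF//; lra.
have bp : b * p = p - 2 by rewrite /b; field.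
have b0 : 0 < b by nra.
have b1 : b <= 1 by nra.
pose V := 16 * (p - 1) ^+ 2 * (2 * p - 1) / (p ^+ 4 * (p + 1)).
have [p4|p4] := leP p 4.
  (* V is 1 at p = 2 and 63/80 at p = 4. *)
  have V34 : 3 / 4 <= V.
    rewrite ler_pdivlMr; last by rewrite mulr_gt0 ?exprn_gt0//; lra.
    pose s := p - 2; have -> : p = s + 2 by rewrite /s subrK.
    have s0 : 0 <= s by rewrite /s; lra.
    have s2 : s <= 2 by rewrite /s; lra.
    rewrite -subr_ge0.
    have -> : 16 * (s + 2 - 1) ^+ 2 * (2 * (s + 2) - 1) - 3 / 4 * ((s + 2) ^+ 4 * (s + 2 + 1)) =
      (48 + 176 * s + s ^+ 2 * (136 - 16 * s - 33 * s ^+ 2 - 3 * s ^+ 3)) / 4 by field.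
    have h3 : s ^+ 3 <= 8 by rewrite [leRHS](_ : _ = 2 ^+ 3); [rewrite lerXn2r ?nnegrE|ring].
    have h2 : s ^+ 2 <= 4 by nra.
    have : 0 <= s ^+ 2 by rewrite sqr_ge0.
    by nra.
  (* The coefficient from [powR_quadratic_le2] at q = p / 2, equal to (p - 2)^2 / 25; with V >= 3/4
     the gain is 3 (p - 2)^2 / 100. *)
  pose k := (p / 2 - 1) ^+ 2 * (4 / 25).
  have kE : k = (p - 2) ^+ 2 / 25 by rewrite /k; field.
  have k0 : 0 <= k by rewrite kE divr_ge0 ?sqr_ge0.
  apply: (@lt_le_trans _ _ (1 + k * (V - 0))%:E).
    have s0 : 0 < p - 2 by lra.
    have R1 := Rfun_le_sq (ltW s0).
    have R2 : Rfun (p - 2) < 1 by apply: le_lt_trans R1 _; nra.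
    rewrite lte_fin; apply: le_lt_trans (expR_le_inv R2) _.
    have R3 : (1 - Rfun (p - 2))^-1 <= (1 - (p - 2) ^+ 2 / 48)^-1.
      by rewrite lef_pV2 ?posrE; nra.
    apply: le_lt_trans R3 _; rewrite subr0.
    apply: (@lt_le_trans _ _ (1 + (p - 2) ^+ 2 * (3 / 100))); last by rewrite kE; nra.
    rewrite -div1r ltr_pdivrMr; last by nra.
    by nra.
  apply: operator_norm_ge_large => //; first by rewrite -/V; nra.
  move=> t; rewrite -/b => /andP[t1 t2]; rewrite subr0.
  apply: powR_quadratic_le2.
    by apply/andP; split; lra.
  apply/andP; split; first by apply: lt_le_trans t1; rewrite exprn_gt0.
  by apply: le_trans t2 _; have : b <= 1 / 2; nra.
(* [k] and [e] come from [powR_quadratic_ge2] at q = p / 2. The gain k (V - e) is 9/40 at p = 4 and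
   at least 1/5 beyond, while exp R <= 24/23. *)
pose k := (p / 2) ^+ 2 / 4.
pose e := (1 - b ^+ 2) ^+ 2.
have kE : k * (V - e) = (p - 1) ^+ 2 * (p - 2) / (p ^+ 2 * (p + 1)).
  by rewrite /k /V /e /b; field; rewrite pn0 p1n0.
have rho : 1 / 5 <= k * (V - e).
  rewrite kE ler_pdivlMr; last by rewrite mulr_gt0 ?exprn_gt0//; lra.
  pose r := p - 4; have -> : p = r + 4 by rewrite /r subrK.
  have r0 : 0 <= r by rewrite /r; lra.
  rewrite -subr_ge0.
  have -> : (r + 4 - 1) ^+ 2 * (r + 4 - 2) - 1 / 5 * ((r + 4) ^+ 2 * (r + 4 + 1)) =
    (10 + 49 * r + 27 * r ^+ 2 + 4 * r ^+ 3) / 5 by field.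
  have : 0 <= r ^+ 3 by rewrite exprn_ge0.
  have : 0 <= r ^+ 2 by rewrite sqr_ge0.
  by lra.
apply: (@lt_le_trans _ _ (1 + k * (V - e))%:E).
  have R1 : Rfun (p - 2) <= 24^-1 by apply: Rfun_le_inv24; lra.
  rewrite lte_fin; apply: le_lt_trans (expR_le_inv _) _; first by lra.
  apply: (@le_lt_trans _ _ (1 - 24^-1)^-1); first by rewrite lef_pV2 ?posrE; lra.
  apply: (@lt_le_trans _ _ (1 + 1 / 5)); last by rewrite lerD2l.
  by rewrite -div1r ltr_pdivrMr; lra.
apply: operator_norm_ge_large => //.
  by rewrite -/V; apply: addr_ge0 => //; apply: le_trans rho; rewrite divr_ge0.
move=> t; rewrite -/b => /andP[t1 t2].
by apply: powR_quadratic_ge2 => //; [lra|rewrite (ltW b0)].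
Qed.

End LargeExponentBound.

(** * Exponents below 2 *)

Section SmallExponent.
Context {R : realType}.
Notation mu := (@lebesgue_measure R).
Implicit Types (a b c d p s t x nu : R).

Lemma integral_pwZ c a d : 0 <= c ->
  (\int[mu]_(x in `]0%R, +oo[) (c * pw a d x)%:E =
   c%:E * \int[mu]_(x in `]0%R, +oo[) (pw a d x)%:E)%E.
Proof.
move=> c0; under eq_integral do rewrite EFinM.
rewrite ge0_integralZl_EFin//.
- by move=> x _; rewrite lee_fin pw_ge0.
- by apply/measurable_EFinP; apply: continuous_gt0_measurable => x; exact: continuous_pw.
Qed.

Lemma integral_pwD c a c' a' d : 0 <= c -> 0 <= c' ->
  (\int[mu]_(x in `]0%R, +oo[) (c * pw a d x + c' * pw a' d x)%:E =
   c%:E * \int[mu]_(x in `]0%R, +oo[) (pw a d x)%:E +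
   c'%:E * \int[mu]_(x in `]0%R, +oo[) (pw a' d x)%:E)%E.
Proof.
move=> c0 c'0; under eq_integral do rewrite EFinD.
have m e a0 : measurable_fun (`]0, +oo[ : set R) (EFin \o (fun x => e * pw a0 d x)).
  apply/measurable_EFinP; apply: continuous_gt0_measurable => x x0.
  by apply: cvgM; [exact: cvg_cst|exact: continuous_pw].
rewrite ge0_integralD//.
- by rewrite !integral_pwZ.
- by move=> x _; rewrite lee_fin mulr_ge0 ?pw_ge0.
- exact: m.
- by move=> x _; rewrite lee_fin mulr_ge0 ?pw_ge0.
- exact: m.
Qed.

Lemma le_integral_gt0 (f g : R -> R) : (forall x, 0 < x -> 0 <= f x) ->
  (forall x, 0 < x -> {for x, continuous f}) ->
  (forall x, 0 < x -> {for x, continuous g}) ->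
  (forall x, 0 < x -> f x <= g x) ->
  (\int[mu]_(x in `]0%R, +oo[) (f x)%:E <= \int[mu]_(x in `]0%R, +oo[) (g x)%:E)%E.
Proof.
move=> f0 cf cg fg; apply: ge0_le_integral => //=.
- by move=> x; rewrite in_itv/= andbT => x0; rewrite lee_fin f0.
- by apply/measurable_EFinP; exact: continuous_gt0_measurable.
- by apply/measurable_EFinP; exact: continuous_gt0_measurable.
- by move=> x; rewrite in_itv/= andbT => x0; rewrite lee_fin fg.
Qed.

(** For d = -3p/2 the substitution x -> 1 / x reflects the order a to 3p - 2 - a: it exchanges p
    with 2p - 2, and p - 2 with 2p. *)
Lemma integral_pw_inv a d :
  (\int[mu]_(x in `]0%R, +oo[) (pw a d x)%:E =
   \int[mu]_(x in `]0%R, +oo[) (pw (- a - 2 * d - 2) d x)%:E)%E.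
Proof.
rewrite integral_inv; [|by move=> x _; exact: pw_ge0|by move=> x; exact: continuous_pw].
apply: eq_integral => x; rewrite inE/= in_itv/= andbT => x0; congr _%:E.
have xV0 : 0 < x^-1 by rewrite invr_gt0.
have xn0 : x != 0 by rewrite gt_eqF.
have sx : 1 + x^-1 ^+ 2 = (1 + x ^+ 2) * x `^ (- 2%:R).
  by rewrite powR_invn ?(ltW x0)// mulrDl mul1r mulfV ?expf_neq0// exprVn addrC.
rewrite /pw sx powRM ?powR_ge0 ?(ltW (onesqr_gt0 _))// -[x^-1]powR_inv1 ?(ltW x0)//.
rewrite -!powRrM -(powR_invn 2 (ltW x0)) mulrCA -mulrA -!powRD ?xn0 ?implybT//.
by rewrite mulrC; congr (_ `^ _ * _); ring.
Qed.

(** * Moments of (1 + x^2)^(-3p/2) *)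

Section Moments.
Context (p : R) (p1 : 1 < p) (p2 : p < 2).
Let D : R := - (3 / 2 * p).
Local Notation M a := (\int[mu]_(x in `]0%R, +oo[) (pw a D x)%:E)%E.

(** The derivative of x^(p - 1) (1 + x^2)^(1 - 3p/2). Expanding one factor 1 + x^2 leaves only the
    orders p - 2 and p, so (p - 1) M(p - 2) = (2p - 1) M(p), obtained below as two inequalities. *)
Let dF x : R := (p - 1) * pw (p - 1 - 1) (1 + D) x +
  2 * (1 + D) * pw (p - 1 + 1) (1 + D - 1) x.

Let cdF x : 0 < x -> {for x, continuous dF}.
Proof.
move=> x0; apply: cvgD; (apply: cvgM; first exact: cvg_cst); exact: continuous_pw.
Qed.

Let dFE x : 0 < x -> dF x = (p - 1) * pw (p - 2) D x - (2 * p - 1) * pw p D x.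
Proof.
move=> x0; rewrite /dF.
have -> : pw (p - 1 - 1) (1 + D) x = pw (p - 2) D x + pw p D x.
  have -> : pw p D x = pw (p - 2 + 2) (1 + D - 1) x by congr (pw _ _ _); ring.
  rewrite pw_shift// (_ : p - 1 - 1 = p - 2); last by ring.
  have -> : pw (p - 2) D x = pw (p - 2) (1 + D) x / (1 + x ^+ 2).
    have -> : pw (p - 2) (1 + D) x = pw (p - 2) D x * pw 0 1 x.
      by rewrite pwD//; congr (pw _ _ _); ring.
    by rewrite /pw powRr0 mul1r powRr1 ?(ltW (onesqr_gt0 _))// mulfK// gt_eqF// onesqr_gt0.
  by field; rewrite gt_eqF// onesqr_gt0.
have -> : pw (p - 1 + 1) (1 + D - 1) x = pw p D x by congr (pw _ _ _); ring.
by rewrite /D; field.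
Qed.

Let Fcvg : pw (p - 1) (1 + D) x @[x --> 0^'+] --> (0 : R) /\
  pw (p - 1) (1 + D) x @[x --> +oo%R] --> (0 : R).
Proof.
have pgt1 := p1; have plt2 := p2.
apply: (@cvg_dominated_pw _ _ 1 (p - 1)) => [|x x0]; first by rewrite subr_gt0.
by rewrite ger0_norm ?pw_ge0// mul1r ler_pw// /D; lra.
Qed.

Lemma moment_pm2_le : ((p - 1)%:E * M (p - 2) <= (2 * p - 1)%:E * M p)%E.
Proof.
have pgt1 := p1; have plt2 := p2.
have [F0 Foo] := Fcvg.
rewrite -!integral_pwZ; [|lra|lra].
apply: (@le_integral_derive _ (fun x => - pw (p - 1) (1 + D) x) (fun x => - dF x)).
- by move=> x _; rewrite mulr_ge0 ?pw_ge0//; lra.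
- by move=> x _; rewrite mulr_ge0 ?pw_ge0//; lra.
- by move=> x x0; apply: cvgM; [exact: cvg_cst|exact: continuous_pw].
- by move=> x x0; apply: cvgM; [exact: cvg_cst|exact: continuous_pw].
- by move=> x x0; apply: cvgN; exact: cdF.
- by move=> x x0; exact: (is_deriveN (is_derive_pw _ _ x0)).
- by rewrite -[X in _ --> X]oppr0; apply: cvgN; exact: F0.
- by rewrite -[X in _ --> X]oppr0; apply: cvgN; exact: Foo.
- by move=> x x0; rewrite dFE//; lra.
Qed.

Lemma moment_pm2_ge : ((2 * p - 1)%:E * M p <= (p - 1)%:E * M (p - 2))%E.
Proof.
have pgt1 := p1; have plt2 := p2.
have [F0 Foo] := Fcvg.
rewrite -!integral_pwZ; [|lra|lra].
apply: (@le_integral_derive _ (fun x => pw (p - 1) (1 + D) x) dF).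
- by move=> x _; rewrite mulr_ge0 ?pw_ge0//; lra.
- by move=> x _; rewrite mulr_ge0 ?pw_ge0//; lra.
- by move=> x x0; apply: cvgM; [exact: cvg_cst|exact: continuous_pw].
- by move=> x x0; apply: cvgM; [exact: cvg_cst|exact: continuous_pw].
- exact: cdF.
- by move=> x x0; exact: is_derive_pw.
- exact: F0.
- exact: Foo.
- by move=> x x0; rewrite dFE//; lra.
Qed.

Lemma moment_2p_ge : ((2 * p - 1)%:E * M p <= (p - 1)%:E * M (2 * p))%E.
Proof.
have pgt1 := p1; have plt2 := p2.
rewrite [M (2 * p)]integral_pw_inv (_ : - (2 * p) - 2 * D - 2 = p - 2).
  exact: moment_pm2_ge.
by rewrite /D; field.
Qed.

(** For p <= 3/2 the order 1 lies between 2p - 2 and p. With 1 = la p + (1 - la) (2p - 2), Bernoulli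
    bounds x by the corresponding combination of powers, and inversion makes both moments equal to
    M(p). *)
Lemma moment_1_le : p <= 3 / 2 -> (M 1 <= M p)%E.
Proof.
have pgt1 := p1; have plt2 := p2.
move=> p32; pose la := (3 - 2 * p) / (2 - p).
have la0 : 0 <= la by rewrite divr_ge0; lra.
have la1 : la <= 1 by rewrite ler_pdivrMr; lra.
have -> : M p = (la%:E * M p + (1 - la)%:E * M (2 * p - 2))%E.
  have -> : (M (2 * p - 2) = M p)%E.
    rewrite [RHS]integral_pw_inv (_ : - p - 2 * D - 2 = 2 * p - 2)//.
    by rewrite /D; field.
  rewrite -ge0_muleDl ?lee_fin ?subr_ge0//.
  by rewrite -EFinD subrKC mul1e.
rewrite -integral_pwD ?subr_ge0//.
apply: le_integral_gt0 => x x0.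
- exact: pw_ge0.
- exact: continuous_pw.
- by apply: cvgD; (apply: cvgM; first exact: cvg_cst); exact: continuous_pw.
- have la01 : 0 <= la <= 1 by rewrite la0.
  have := powR_bernoulli_le la01 (powR_ge0 x (2 - p)).
  rewrite -powRrM (_ : (2 - p) * la = 3 - 2 * p); last by rewrite /la; field; lra.
  move=> h; have := ler_wpM2l (pw_ge0 (2 * p - 2) D x) h.
  have e1 : pw (2 * p - 2) D x * x `^ (3 - 2 * p) = pw 1 D x.
    by rewrite pw_mul_powR//; congr (pw _ _ _); ring.
  have e2 : pw (2 * p - 2) D x * x `^ (2 - p) = pw p D x.
    by rewrite pw_mul_powR//; congr (pw _ _ _); ring.
  by rewrite e1 mulrDr mulr1 mulrCA mulrBr mulr1 e2; lra.
Qed.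

End Moments.

End SmallExponent.

(** * Line integrals off the boundary for p < 2 *)

Section SmallExponentShift.
Context {R : realType}.
Notation mu := (@lebesgue_measure R).
Implicit Types (a b c d p s t x nu : R).

(** For r = c / (a + b) in [0, 1] one has r <= r^s; add the cases c = a and c = b. *)
Lemma powR_subadditive a b s : 0 <= a -> 0 <= b -> 0 < s <= 1 ->
  (a + b) `^ s <= a `^ s + b `^ s.
Proof.
move=> a0 b0 /andP[s0 s1].
have [ab0|ab0] := leP (a + b) 0.
  have -> : a + b = 0 by apply/eqP; rewrite eq_le ab0 addr_ge0.
  by rewrite powR0 ?gt_eqF// addr_ge0 ?powR_ge0.
have part c : 0 <= c -> c <= a + b -> c / (a + b) * (a + b) `^ s <= c `^ s.
  rewrite le_eqVlt => /predU1P[<- _|c0 cab]; first by rewrite mul0r mul0r powR_ge0.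
  have -> : c `^ s = (c / (a + b)) `^ s * (a + b) `^ s.
    by rewrite -powRM ?divrK ?unitfE ?gt_eqF//; [exact/ltW/divr_gt0|exact: ltW].
  rewrite ler_wpM2r ?powR_ge0// ger1_powR// divr_gt0//=.
  by rewrite ler_pdivrMr// mul1r.
have -> : (a + b) `^ s = a / (a + b) * (a + b) `^ s + b / (a + b) * (a + b) `^ s.
  by rewrite -mulrDl -mulrDl divff ?gt_eqF// mul1r.
by apply: lerD; apply: part => //; rewrite ?lerDl ?lerDr.
Qed.

(* At p = 1 both sides equal 1; F is the difference of the two antiderivatives
   at p = 1, multiplied by (1 + x^2)^(3/2 (1 - p)). *)
Lemma moment_0_le p : 1 < p ->
  (\int[mu]_(x in `]0%R, +oo[) (pw 0 (- (3 / 2 * p)) x)%:E <=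
   (3 * p - 2)%:E * \int[mu]_(x in `]0%R, +oo[) (pw 1 (- (3 / 2 * p)) x)%:E)%E.
Proof.
move=> p1; set D := - (3 / 2 * p).
rewrite -integral_pwZ; last by lra.
pose F x := pw 0 (D + 3 / 2) x - pw 1 (1 + D) x - pw 0 (1 + D) x.
pose dF x := 0 * pw (0 - 1) (D + 3 / 2) x + 2 * (D + 3 / 2) * pw (0 + 1) (D + 3 / 2 - 1) x -
  (1 * pw (1 - 1) (1 + D) x + 2 * (1 + D) * pw (1 + 1) (1 + D - 1) x) -
  (0 * pw (0 - 1) (1 + D) x + 2 * (1 + D) * pw (0 + 1) (1 + D - 1) x).
pose s x : R := (1 + x ^+ 2) `^ (1 / 2).
have s2 x : s x ^+ 2 = 1 + x ^+ 2.
  by rewrite -powR_mulrn ?powR_ge0// -powRrM mul1r mulVf// powRr1// ltW// onesqr_gt0.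
have s0 x : 0 <= s x by exact: powR_ge0.
have pwx x e : 0 < x -> pw 1 e x = x * (1 + x ^+ 2) `^ e.
  by move=> x0; rewrite /pw powRr1// ltW.
have pw0 x e : pw 0 e x = (1 + x ^+ 2) `^ e by rewrite /pw powRr0 mul1r.
have qn0 x : 1 + x ^+ 2 != 0 by rewrite gt_eqF ?onesqr_gt0.
have sD x e : (1 + x ^+ 2) `^ (e + 1 / 2) = (1 + x ^+ 2) `^ e * s x.
  by rewrite /s -powRD ?qn0 ?implybT.
have sD2 x e : (1 + x ^+ 2) `^ (e + 1) = (1 + x ^+ 2) `^ e * s x ^+ 2.
  by rewrite s2 powRD ?qn0 ?implybT// powRr1// ltW// onesqr_gt0.
have FE x : 0 < x -> F x = (1 + x ^+ 2) `^ (1 + D) * (s x - x - 1).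
  move=> x0; rewrite /F !pw0 pwx// (_ : D + 3 / 2 = 1 + D + 1 / 2); last by field.
  by rewrite sD; ring.
have [F0 Foo] : F x @[x --> 0^'+] --> (0 : R) /\ F x @[x --> +oo%R] --> (0 : R).
  apply: (@cvg_dominated_pw _ F 1 (1 / 2)) => // x x0.
  rewrite FE// normrM ger0_norm ?powR_ge0// mul1r /pw mulrC.
  have h1 : x <= s x by have := s2 x; have := s0 x; nra.
  have h2 : 1 <= s x by have := s2 x; have := s0 x; nra.
  have h3 : s x <= 1 + x by have := s2 x; have := s0 x; nra.
  apply: ler_pM; rewrite ?normr_ge0 ?powR_ge0//.
    rewrite ler0_norm; last by lra.
    rewrite mul1r powR12_sqrt ?(ltW x0)//.
    have y0 : 0 <= - (s x - x - 1) by lra.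
    rewrite -[leLHS]ger0_norm// -sqrtr_sqr ler_wsqrtr//; nra.
  by rewrite ler_powR ?onesqr_ge1// /D; lra.
apply: (@le_integral_derive _ F dF) => //.
- by move=> x x0; rewrite mulr_ge0 ?pw_ge0//; lra.
- by move=> x _; exact: pw_ge0.
- by move=> x x0; apply: cvgM; [exact: cvg_cst|exact: continuous_pw].
- by move=> x; exact: continuous_pw.
- move=> x x0; apply: cvgB; first apply: cvgB;
    by apply: cvgD; (apply: cvgM; first exact: cvg_cst); exact: continuous_pw.
- move=> x x0; apply: is_deriveB; first apply: is_deriveB; exact: is_derive_pw.
- move=> x x0.
  have e1 : pw (0 + 1) (D + 3 / 2 - 1) x = x * (1 + x ^+ 2) `^ D * s x.
    rewrite (_ : D + 3 / 2 - 1 = D + 1 / 2); last by field.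
    by rewrite add0r pwx// sD mulrA.
  have e2 : pw (1 - 1) (1 + D) x = (1 + x ^+ 2) `^ D * s x ^+ 2.
    by rewrite subrr pw0 (addrC 1 D) sD2.
  have e3 : pw (1 + 1) (1 + D - 1) x = x ^+ 2 * (1 + x ^+ 2) `^ D.
    by rewrite /pw -[1 + 1]/(2%:R) powR_mulrn ?(ltW x0)// (_ : 1 + D - 1 = D)//; ring.
  have e4 : pw (0 + 1) (1 + D - 1) x = x * (1 + x ^+ 2) `^ D.
    by rewrite add0r pwx// (_ : 1 + D - 1 = D)//; ring.
  rewrite /dF e1 e2 e3 e4 pw0 pwx// s2.
  set w := _ `^ D; have w0 : 0 <= w by exact: powR_ge0.
  have h1 : x <= s x by have := s2 x; have := s0 x; nra.
  rewrite -subr_ge0.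
  (* Since 3p - 2 = -2 (1 + D), the terms linear in x cancel; the rest has the sign of (p - 1)
     (sqrt(1 + x^2) - x). *)
  have -> : (3 * p - 2) * (x * w) - (w + (0 * pw (0 - 1) (D + 3 / 2) x + 2 * (D + 3 / 2) *
     (x * w * s x) - (1 * (w * (1 + x ^+ 2)) + 2 * (1 + D) * (x ^+ 2 * w)) -
     (0 * pw (0 - 1) (1 + D) x + 2 * (1 + D) * (x * w)))) =
     w * ((3 * p - 3) * (x * (s x - x))) by rewrite /D; field.
  rewrite mulr_ge0// mulr_ge0; first by [].
    by lra.
  by rewrite mulr_ge0 ?subr_ge0// ltW.
Qed.

(* For p near 1 the moment of order p - 2 is too large for the tangent bound
   (x^2 + nu^2)^(p/2) <= x^p + (p/2) nu^2 x^(p-2); subadditivity replaces it. *)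
Lemma integral_shift_le p nu S : 1 < p -> p < 2 -> 0 < nu < 1 -> 0 <= S ->
  (\int[mu]_(x in `]0%R, +oo[) (pw p (- (3 / 2 * p)) x)%:E = S%:E)%E ->
  (\int[mu]_(x in `]0%R, +oo[)
     ((x ^+ 2 + nu ^+ 2) `^ (p / 2) * (1 + x ^+ 2) `^ (- (3 / 2 * p)))%:E <=
   ((1 + (2 * p - 1) * (nu + nu ^+ 2)) * S)%:E)%E.
Proof.
move=> p1 p2 /andP[nu0 nu1] S0; set D := - (3 / 2 * p) => SE.
have p12 : 0 < p / 2 <= 1 by apply/andP; split; lra.
have cf x : 0 < x -> {for x, continuous
    (fun x => (x ^+ 2 + nu ^+ 2) `^ (p / 2) * (1 + x ^+ 2) `^ D)}.
  move=> x0; apply: cvgM.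
    apply: cvg_powR_gt0; first by rewrite addr_gt0 ?exprn_gt0.
    by apply: cvgD; [exact: exprn_continuous|exact: cvg_cst].
  apply: cvg_powR_gt0; first exact: onesqr_gt0.
  by apply: cvgD; [exact: cvg_cst|exact: exprn_continuous].
have f0 x : 0 < x -> 0 <= (x ^+ 2 + nu ^+ 2) `^ (p / 2) * (1 + x ^+ 2) `^ D.
  by move=> _; rewrite mulr_ge0 ?powR_ge0.
have nu2 : nu ^+ 2 <= nu by nra.
have [p32|p32] := leP p (3 / 2).
  apply: (@le_trans _ _ (1%:E * \int[mu]_(x in `]0%R, +oo[) (pw p D x)%:E +
      (nu `^ p)%:E * \int[mu]_(x in `]0%R, +oo[) (pw 0 D x)%:E)%E).
    rewrite -integral_pwD ?powR_ge0//; apply: le_integral_gt0 => // x x0.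
      by apply: cvgD; (apply: cvgM; first exact: cvg_cst); exact: continuous_pw.
    rewrite mul1r /pw powRr0 mul1r -mulrDl ler_wpM2r ?powR_ge0//.
    rewrite -(sqr_powR p (ltW x0)) -(sqr_powR p (ltW nu0)).
    by apply: powR_subadditive; rewrite ?sqr_ge0.
  have M0 := moment_0_le p1; rewrite -/D in M0.
  have M1 : (\int[mu]_(x in `]0%R, +oo[) (pw 1 D x)%:E <= S%:E)%E.
    by rewrite -SE; exact: moment_1_le.
  have M01 : (\int[mu]_(x in `]0%R, +oo[) (pw 0 D x)%:E <= ((3 * p - 2) * S)%:E)%E.
    apply: (le_trans M0); rewrite EFinM; apply: lee_wpmul2l => //.
    by rewrite lee_fin; lra.
  rewrite SE mul1e; apply: (@le_trans _ _ (S%:E + (nu `^ p)%:E * ((3 * p - 2) * S)%:E)%E).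
    by apply: leeD2l; apply: lee_wpmul2l; rewrite ?lee_fin ?powR_ge0.
  rewrite -EFinM -EFinD lee_fin.
  have -> : S + nu `^ p * ((3 * p - 2) * S) = (1 + (3 * p - 2) * nu `^ p) * S by ring.
  rewrite ler_wpM2r// lerD2l.
  (* Bernoulli for nu^(p - 1), times nu. For p <= 3/2 both weights, multiplied by 3p - 2, stay below
     2p - 1. *)
  have nup : nu `^ p <= (2 - p) * nu + (p - 1) * nu ^+ 2.
    have pm1 : 0 <= p - 1 <= 1 by apply/andP; split; lra.
    have h := powR_bernoulli_le pm1 (ltW nu0).
    rewrite -mulr_powRB1 ?(ltW nu0)//; last by lra.
    by have := ler_wpM2l (ltW nu0) h; rewrite -/(nu `^ _); nra.
  apply: (@le_trans _ _ ((3 * p - 2) * ((2 - p) * nu + (p - 1) * nu ^+ 2))).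
    by rewrite ler_wpM2l//; lra.
  have c1 : (3 * p - 2) * (2 - p) <= 2 * p - 1 by nra.
  have c2 : (3 * p - 2) * (p - 1) <= 2 * p - 1 by nra.
  have nn : 0 <= nu ^+ 2 by rewrite sqr_ge0.
  have := ler_wpM2r (ltW nu0) c1; have := ler_wpM2r nn c2; lra.
apply: (@le_trans _ _ (1%:E * \int[mu]_(x in `]0%R, +oo[) (pw p D x)%:E +
    (p / 2 * nu ^+ 2)%:E * \int[mu]_(x in `]0%R, +oo[) (pw (p - 2) D x)%:E)%E).
  have c0 : 0 <= p / 2 * nu ^+ 2 by rewrite mulr_ge0 ?sqr_ge0//; lra.
  rewrite -integral_pwD//; apply: le_integral_gt0 => // x x0.
    by apply: cvgD; (apply: cvgM; first exact: cvg_cst); exact: continuous_pw.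
  rewrite mul1r /pw [X in _ <= _ + X]mulrA -mulrDl ler_wpM2r ?powR_ge0//.
  have p12' : 0 <= p / 2 <= 1 by apply/andP; split; lra.
  have y0 : 0 <= 1 + nu ^+ 2 / x ^+ 2 by rewrite addr_ge0// divr_ge0 ?sqr_ge0.
  have -> : x ^+ 2 + nu ^+ 2 = x ^+ 2 * (1 + nu ^+ 2 / x ^+ 2).
    by field; rewrite gt_eqF.
  rewrite powRM ?sqr_ge0// (sqr_powR p (ltW x0)).
  have -> : x `^ (p - 2) = x `^ p / x ^+ 2.
    rewrite powRB; last by rewrite (gt_eqF x0) implybT.
    by rewrite (powR_mulrn 2 (ltW x0)).
  have := ler_wpM2l (powR_ge0 x p) (powR_bernoulli_le p12' y0).
  by move=> /le_trans; apply; rewrite le_eqVlt; apply/orP; left; apply/eqP; ring.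
have Mm := moment_pm2_le p1 p2; rewrite -/D SE in Mm.
have pm1 : 0 < p - 1 by lra.
have {}Mm : (\int[mu]_(x in `]0%R, +oo[) (pw (p - 2) D x)%:E <=
    ((2 * p - 1) / (p - 1) * S)%:E)%E.
  have pV : (0 <= ((p - 1)^-1)%:E)%E by rewrite lee_fin invr_ge0 ltW.
  have := lee_wpmul2l pV Mm.
  rewrite !muleA -!EFinM mulVf ?gt_eqF// mul1e => /le_trans; apply.
  by rewrite lee_fin [_^-1 * _]mulrC.
have c0 : 0 <= p / 2 * nu ^+ 2 by rewrite mulr_ge0 ?sqr_ge0//; lra.
rewrite SE mul1e; apply: (@le_trans _ _ (S%:E + (p / 2 * nu ^+ 2)%:E *
    ((2 * p - 1) / (p - 1) * S)%:E)%E).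
  by apply: leeD2l; apply: lee_wpmul2l.
rewrite -EFinM -EFinD lee_fin.
have -> : S + p / 2 * nu ^+ 2 * ((2 * p - 1) / (p - 1) * S) =
  (1 + (2 * p - 1) * (p / (2 * (p - 1)) * nu ^+ 2)) * S by field; rewrite gt_eqF.
rewrite ler_wpM2r// lerD2l ler_wpM2l//; first by lra.
(* p > 3/2 is more than enough here; then 2 nu^2 <= nu + nu^2. *)
have c1 : p / (2 * (p - 1)) <= 2 by rewrite ler_pdivrMr; lra.
have nn : 0 <= nu ^+ 2 by rewrite sqr_ge0.
apply: (le_trans (ler_wpM2r nn c1)); lra.
Qed.

End SmallExponentShift.

(** * The test function z^2 / (2 (z + i)^2) *)

Section SmallExponentTestFunction.
Local Open Scope complex_scope.
Context {R : realType}.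
Notation mu := (@lebesgue_measure R).
Implicit Types (w : R[i]^o) (a b c d p s x y nu : R).

(** The tangent at the midpoint lies above the power at both points, and its linear terms cancel in
    the sum. *)
Lemma powR_midpoint a b s : 0 <= a -> 0 <= b -> 0 <= s <= 1 ->
  2^-1 * (a `^ s + b `^ s) <= ((a + b) / 2) `^ s.
Proof.
move=> a0 b0 s01; set m := (a + b) / 2.
have m0 : 0 <= m by rewrite divr_ge0 ?addr_ge0.
have [mp|mn] := ltP 0 m; last first.
  have : m = 0 by apply/eqP; rewrite eq_le mn.
  rewrite /m => /eqP; rewrite mulf_eq0 invr_eq0 pnatr_eq0 orbF paddr_eq0//.
  by move=> /andP[/eqP -> /eqP ->]; rewrite addr0 mul0r; lra.
have part c : 0 <= c -> c `^ s <= m `^ s * (1 + s * (c / m - 1)).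
  move=> c0; have cm0 : 0 <= c / m by exact: divr_ge0.
  have -> : c `^ s = m `^ s * (c / m) `^ s.
    by rewrite -powRM// mulrCA divff ?mulr1// gt_eqF.
  by rewrite ler_wpM2l ?powR_ge0//; exact: powR_bernoulli_le.
have mE : a / m + b / m = 2.
  by rewrite -mulrDl /m invf_div mulrCA divff ?mulr1// gt_eqF// -[0](mul0r 2) -ltr_pdivlMr.
have := lerD (part a a0) (part b b0).
rewrite -mulrDr (_ : _ + (1 + _) = 2); last first.
  have -> : b / m = 2 - a / m by rewrite -mE [_ + b / m]addrC addrK.
  by move: (a / m) => r; ring.
by lra.
Qed.

(** The midpoint inequality separates the two squares in |V f|^2 / |f|^2, with factor 2^(p/2) / 2.
    The pieces are moments of orders 2p and p, compared by [moment_2p_ge]. *)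
Lemma integral_boundary_ge p S : 1 < p -> p < 2 -> 0 <= S ->
  (\int[mu]_(x in `]0%R, +oo[) (pw p (- (3 / 2 * p)) x)%:E = S%:E)%E ->
  ((2 `^ (p / 2) / 2 * (((p - 1) / p) `^ p * ((2 * p - 1) / (p - 1)) + p^-1 `^ p) * S)%:E <=
   \int[mu]_(x in `]0%R, +oo[) (pw p (- (3 / 2 * p)) x *
     (((p - 1) / p) ^+ 2 * x ^+ 2 + p^-1 ^+ 2) `^ (p / 2))%:E)%E.
Proof.
move=> p1 p2 S0; set D := - (3 / 2 * p) => SE.
set al := (p - 1) / p; set ga := p^-1; set k := 2 `^ (p / 2) / 2.
have p0 : 0 < p by lra.
have pm1 : 0 < p - 1 by lra.
have al0 : 0 < al by rewrite divr_gt0.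
have ga0 : 0 < ga by rewrite invr_gt0.
have k0 : 0 <= k by rewrite divr_ge0 ?powR_ge0.
have M2 : (((2 * p - 1) / (p - 1) * S)%:E <=
    \int[mu]_(x in `]0%R, +oo[) (pw (2 * p) D x)%:E)%E.
  have := moment_2p_ge p1 p2; rewrite -/D SE => M2p.
  have pV : (0 <= ((p - 1)^-1)%:E)%E by rewrite lee_fin invr_ge0 ltW.
  have := lee_wpmul2l pV M2p.
  rewrite !muleA -!EFinM mulVf ?gt_eqF// mul1e; apply: le_trans.
  by rewrite lee_fin [_^-1 * _]mulrC.
apply: (@le_trans _ _ ((k * al `^ p)%:E * \int[mu]_(x in `]0%R, +oo[) (pw (2 * p) D x)%:E +
    (k * ga `^ p)%:E * \int[mu]_(x in `]0%R, +oo[) (pw p D x)%:E)%E).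
  rewrite SE; apply: (@le_trans _ _ ((k * al `^ p)%:E * ((2 * p - 1) / (p - 1) * S)%:E +
    (k * ga `^ p)%:E * S%:E)%E).
    by rewrite -!EFinM -EFinD lee_fin le_eqVlt; apply/orP; left; apply/eqP; ring.
  by apply: leeD2r; apply: lee_wpmul2l => //; rewrite lee_fin mulr_ge0 ?powR_ge0.
have ka0 : 0 <= k * al `^ p by rewrite mulr_ge0 ?powR_ge0.
have kg0 : 0 <= k * ga `^ p by rewrite mulr_ge0 ?powR_ge0.
rewrite -(integral_pwD (2 * p) p D ka0 kg0); apply: le_integral_gt0 => x x0.
- by apply: addr_ge0; apply: mulr_ge0 => //; exact: pw_ge0.
- by apply: cvgD; (apply: cvgM; first exact: cvg_cst); exact: continuous_pw.
- apply: cvgM; first exact: continuous_pw.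
  apply: cvg_powR_gt0; first by rewrite addr_gt0 ?mulr_gt0 ?exprn_gt0.
  apply: cvgD; last exact: cvg_cst.
  by apply: cvgM; [exact: cvg_cst|exact: exprn_continuous].
- have p12 : 0 <= p / 2 <= 1 by apply/andP; split; lra.
  have h := powR_midpoint (mulr_ge0 (sqr_ge0 al) (sqr_ge0 x)) (sqr_ge0 ga) p12.
  have -> : pw (2 * p) D x = pw p D x * x `^ p.
    by rewrite pw_mul_powR//; congr (pw _ _ _); ring.
  have -> : k * al `^ p * (pw p D x * x `^ p) + k * ga `^ p * pw p D x =
      pw p D x * (2 `^ (p / 2) * (2^-1 * (al `^ p * x `^ p + ga `^ p))) by rewrite /k; ring.
  rewrite ler_wpM2l ?pw_ge0//.
  have e1 : (al ^+ 2 * x ^+ 2) `^ (p / 2) = al `^ p * x `^ p.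
    by rewrite powRM ?sqr_ge0// (sqr_powR p (ltW al0)) (sqr_powR p (ltW x0)).
  rewrite e1 (sqr_powR p (ltW ga0)) in h.
  apply: le_trans (ler_wpM2l (powR_ge0 2 (p / 2)) h) _.
  have A0 : 0 <= (al ^+ 2 * x ^+ 2 + ga ^+ 2) / 2.
    apply: divr_ge0 => //; apply: addr_ge0; last exact: sqr_ge0.
    by apply: mulr_ge0; exact: sqr_ge0.
  by rewrite -powRM// mulrCA divff ?mulr1.
Qed.

Let H w : R[i]^o := (2^-1)%:C * (w * invi w) ^+ 2.
Let f w : R[i]^o := 'i * w * invi w ^+ 3.

Let dH w : 0 <= complex.Im w -> is_derive w (1 : R[i]^o) H (f w).
Proof.
move=> w0; have dv := is_derive_invi w0.
have dm := is_deriveM (is_derive_id w (1 : R[i]^o)) dv.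
apply: (is_derive_eq (is_deriveZ ((2^-1)%:C : R[i]) (is_deriveX 2 dm))).
rewrite /f /GRing.scale/= expr1.
have two : (2^-1)%:C * 2 = 1 :> R[i].
  by rewrite -(rmorph_nat (real_complex R)) -rmorphM/= mulVf// rmorph1.
have -> : w * - invi w ^+ 2 + invi w * 1 = 'i * invi w ^+ 2.
  rewrite mulr1 -[X in _ + X]mulr1 -[X in _ + _ * X](inviK w0); ring.
rewrite [(id * invi) w](_ : _ = w * invi w)//.
transitivity ((2^-1)%:C * 2 * ('i * w * invi w ^+ 3)); first by ring.
by rewrite two mul1r.
Qed.

Let df w : 0 <= complex.Im w -> derivable f w (1 : R[i]^o).
Proof.
move=> w0; have dv := is_derive_invi w0.
have ds := is_deriveZ ('i : R[i]) (is_derive_id w (1 : R[i]^o)).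
by have [] := is_deriveM ds (is_deriveX 3 dv).
Qed.

Lemma operator_norm_ge_small p : 1 < p -> p < 2 ->
  ((2 `^ (p / 2) / 2 * (((p - 1) / p) `^ p * ((2 * p - 1) / (p - 1)) + p^-1 `^ p))%:E <=
   operator_norm p (cesaro_V p) `^ p)%E.
Proof.
move=> p1 p2.
have p0 : 0 < p by lra.
have p20 : 0 < p / 2 by rewrite divr_gt0.
set D := - (3 / 2 * p); set al := (p - 1) / p; set ga := p^-1.
have alE : al = 1 - ga by rewrite /al /ga; field; rewrite gt_eqF.
have cubeV q : 0 < q -> ((q^-1) ^+ 3) `^ (p / 2) = q `^ D.
  move=> q0; rewrite exprVn -(powR_invn 3 (ltW q0)) -powRrM.
  by congr (_ `^ _); rewrite /D; field.
have [S S0 SE] : exists2 S : R, 0 < S & (\int[mu]_(x in `]0%R, +oo[) (pw p D x)%:E = S%:E)%E.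
  apply: integral_gt0_fin => x x0; first exact: continuous_pw.
  - exact: pw_gt0.
  - have -> : pw p D x = (x ^+ 2) `^ (p / 2) * (1 + x ^+ 2) `^ D.
      by rewrite sqr_powR// ltW.
    apply: (@le_trans _ _ ((1 + x ^+ 2) `^ (p / 2) * (1 + x ^+ 2) `^ D)).
      rewrite ler_wpM2r ?powR_ge0//; apply: ge0_ler_powR; rewrite ?nnegrE ?sqr_ge0 ?(ltW p20)//.
      by rewrite ltW// onesqr_gt0.
      by rewrite lerDr.
    have qn0 : 1 + x ^+ 2 != 0 by rewrite gt_eqF ?onesqr_gt0.
    rewrite -(powR_inv1 (ltW (onesqr_gt0 x))) -powRD ?qn0 ?implybT//.
    by rewrite ler_powR ?onesqr_ge1// /D; lra.
pose F x y := (x ^+ 2 + y ^+ 2) * ((x ^+ 2 + (1 + y) ^+ 2)^-1) ^+ 3.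
(* The factor 1/2 in [H] halves 2 (p - 1) / p to [al], and 1 - al = ga, so V f = z (al z - ga i) /
   (z + i)^3. *)
pose G x y := (x ^+ 2 + y ^+ 2) * (al ^+ 2 * x ^+ 2 + (al * y - ga) ^+ 2) *
  ((x ^+ 2 + (1 + y) ^+ 2)^-1) ^+ 3.
have cinv y : 0 < y -> continuous (fun x : R => ((x ^+ 2 + (1 + y) ^+ 2)^-1) ^+ 3).
  move=> y0 x; apply: cvg_exp; apply: cvgV; first by rewrite gt_eqF// real_shift_gt0.
  by apply: cvgD; [exact: exprn_continuous|exact: cvg_cst].
have cF y : 0 < y -> continuous (F^~ y).
  move=> y0 x; apply: cvgM; last exact: cinv.
  by apply: cvgD; [exact: exprn_continuous|exact: cvg_cst].
have V0 x y : 0 <= ((x ^+ 2 + (1 + y) ^+ 2)^-1) ^+ 3.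
  by rewrite exprn_ge0// invr_ge0 addr_ge0 ?sqr_ge0.
have F0 x y : 0 <= F x y by rewrite /F mulr_ge0 ?addr_ge0 ?sqr_ge0.
apply: (@operator_norm_cesaro_V_ge _ p H f F G S) => //.
- by rewrite /H mul0r expr0n mulr0.
- move=> x y y0; rewrite /f (nsqM _ (_ ^+ 3)) nsqM nsqX nsq_invi.
  by rewrite /nsq/= expr0n expr1n add0r mul1r.
- move=> x y y0.
  have wn0 : x +i* y != 0 by rewrite eq_complex negb_and orbC /= gt_eqF.
  rewrite (_ : _ - _ = (x +i* y) * (al * x +i* (al * y - ga)) * invi (x +i* y) ^+ 3); last first.
    have -> : al * x +i* (al * y - ga) = al%:C * (x +i* y + 'i) - 'i.
      by apply/eqP; rewrite eq_complex /= alE; apply/andP; split; apply/eqP; ring.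
    have vK := @inviK R (x +i* y) (ltW y0).
    have two : (2 * al)%:C * (2^-1)%:C = al%:C :> R[i].
      by rewrite -rmorphM/= mulrAC divff// mul1r.
    have HE : H (x +i* y) = (x +i* y) * ((2^-1)%:C * ((x +i* y) * invi (x +i* y) ^+ 2)).
      by rewrite /H; ring.
    have v2 : invi (x +i* y) ^+ 2 = invi (x +i* y) ^+ 3 * (x +i* y + 'i).
      by rewrite [in RHS]exprSr -mulrA vK mulr1.
    rewrite HE mulKf// mulrA two v2 /f.
    by ring.
  by rewrite (nsqM _ (_ ^+ 3)) nsqM nsqX nsq_invi /nsq/= exprMn.
- by move=> x y; rewrite /F sqrrN.
- move=> y y0 x; apply: cvgM; last exact: cinv.
  apply: cvgM; first by apply: cvgD; [exact: exprn_continuous|exact: cvg_cst].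
  apply: cvgD; last exact: cvg_cst.
  by apply: cvgM; [exact: cvg_cst|exact: exprn_continuous].
- by move=> x y; rewrite /G sqrrN.
- move=> x y; apply: mulr_ge0 => //; apply: mulr_ge0.
    by apply: addr_ge0; exact: sqr_ge0.
  by apply: addr_ge0; [apply: mulr_ge0; exact: sqr_ge0|exact: sqr_ge0].
- move=> x x0; rewrite /G; apply: cvg_at_right_filter; apply: cvgM.
    apply: cvgM.
      by apply: cvgD; [exact: cvg_cst|exact: exprn_continuous].
    apply: cvgD; first exact: cvg_cst.
    apply: cvg_exp; apply: cvgB; last exact: cvg_cst.
    by apply: cvgM; [exact: cvg_cst|exact: cvg_id].
  apply: cvg_exp; apply: cvgV; first by rewrite addr0 expr1n gt_eqF// addrC onesqr_gt0.
  apply: cvgD; first exact: cvg_cst.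
  by apply: cvg_exp; apply: cvgD; [exact: cvg_cst|exact: cvg_id].
(* Scaling by 1 + y restores the boundary denominator. It leaves the decaying factor k^(1 - 2p),
   which has to pay for the shift nu in the numerator. *)
- move=> y y0; pose k := 1 + y; pose nu := y / k.
  have k0 : 0 < k by rewrite addr_gt0.
  have nu01 : 0 < nu < 1 by rewrite divr_gt0//= ltr_pdivrMr// mul1r ltrDr.
  have cFp x : 0 < x -> {for x, continuous (fun x => F x y `^ (p / 2))}.
    by move=> x0; apply: cvg_powR_ge0 => //; exact: cF.
  rewrite (integral_scale k0)//; last by move=> x _; exact: powR_ge0.
  have E x : 0 < x -> F (k * x) y `^ (p / 2) * k =
      k `^ (1 - 2 * p) * ((x ^+ 2 + nu ^+ 2) `^ (p / 2) * (1 + x ^+ 2) `^ D).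
    move=> x0; rewrite -cubeV ?onesqr_gt0//.
    have -> : F (k * x) y = k `^ (- 4%:R) * ((x ^+ 2 + nu ^+ 2) * ((1 + x ^+ 2)^-1) ^+ 3).
      rewrite powR_invn ?(ltW k0)// /F -/k /nu.
      by field; rewrite !gt_eqF ?onesqr_gt0 ?addr_gt0 ?exprn_gt0 ?mulr_gt0.
    have A0 : 0 <= x ^+ 2 + nu ^+ 2 by rewrite addr_ge0 ?sqr_ge0.
    have C0 : 0 <= ((1 + x ^+ 2)^-1) ^+ 3.
      by rewrite exprn_ge0// invr_ge0; exact/ltW/onesqr_gt0.
    rewrite (powRM _ (powR_ge0 _ _) (mulr_ge0 A0 C0)) (powRM _ A0 C0).
    rewrite -powRrM mulrAC -[X in _ * X * _](powRr1 (ltW k0)) -powRD ?(gt_eqF k0) ?implybT//.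
    by congr (_ `^ _ * _); field.
  rewrite (@eq_integral _ _ _ mu _ (fun x => (k `^ (1 - 2 * p))%:E *
      ((x ^+ 2 + nu ^+ 2) `^ (p / 2) * (1 + x ^+ 2) `^ D)%:E)%E); last first.
    by move=> x; rewrite inE/= in_itv/= andbT => x0; rewrite E.
  rewrite ge0_integralZl_EFin ?powR_ge0//; last 2 first.
  + by move=> x _; rewrite lee_fin mulr_ge0 ?powR_ge0.
  + apply/measurable_EFinP; apply: continuous_gt0_measurable => x x0; apply: cvgM.
      apply: cvg_powR_ge0 => //.
      - by move=> t; rewrite addr_ge0 ?sqr_ge0.
      - by rewrite addr_ge0 ?sqr_ge0.
      by apply: cvgD; [exact: exprn_continuous|exact: cvg_cst].
    apply: cvg_powR_gt0; first exact: onesqr_gt0.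
    by apply: cvgD; [exact: cvg_cst|exact: exprn_continuous].
  have kge0 : (0 <= (k `^ (1 - 2 * p))%:E)%E by rewrite lee_fin powR_ge0.
  apply: (le_trans (lee_wpmul2l kge0 (integral_shift_le p1 p2 nu01 (ltW S0) SE))).
  rewrite -EFinM lee_fin mulrA ler_piMl ?(ltW S0)//.
  have -> : k `^ (1 - 2 * p) = (k `^ (2 * p - 1))^-1 by rewrite -powRN; congr (_ `^ _); ring.
  rewrite mulrC ler_pdivrMr ?powR_gt0// mul1r.
  have r1 : 1 <= 2 * p - 1 by lra.
  (* As k^(2p - 1) >= 1 + (2p - 1) y, it suffices that nu + nu^2 <= y, that is 1 + 2y <= (1 + y)^2;
     hence the form of the bound in [integral_shift_le]. *)
  apply: le_trans (powR_bernoulli_ge r1 (ltW k0)).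
  rewrite lerD2l ler_wpM2l//; first by lra.
  rewrite /nu /k (_ : 1 + y - 1 = y); last by ring.
  have -> : y / (1 + y) + (y / (1 + y)) ^+ 2 = (y * (1 + 2 * y)) / (1 + y) ^+ 2.
    by field; rewrite gt_eqF.
  rewrite ler_pdivrMr ?exprn_gt0// ler_pM2l//.
  by have := sqr_ge0 y; lra.
- apply: (le_trans (integral_boundary_ge p1 p2 (ltW S0) SE)).
  rewrite le_eqVlt; apply/orP; left; apply/eqP; apply: eq_integral => x.
  rewrite inE/= in_itv/= andbT => x0; congr _%:E.
  have q0 := onesqr_gt0 x.
  rewrite /G mulr0 sub0r sqrrN addr0 expr1n expr0n/= addr0 [x ^+ 2 + 1]addrC.
  have A0 := sqr_ge0 x.
  have B0 : 0 <= al ^+ 2 * x ^+ 2 + ga ^+ 2.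
    by apply: addr_ge0; [apply: mulr_ge0; exact: sqr_ge0|exact: sqr_ge0].
  have C0 : 0 <= ((1 + x ^+ 2)^-1) ^+ 3 by rewrite exprn_ge0// invr_ge0 ltW.
  rewrite -/al -/ga -/D (powRM _ (mulr_ge0 A0 B0) C0) (powRM _ A0 B0) cubeV// /pw.
  by rewrite (sqr_powR p (ltW x0)) mulrAC.
Qed.

End SmallExponentTestFunction.

(** * Comparison with exp R below 2 *)

Section SmallExponentBound.
Context {R : realType}.
Implicit Types (p s x : R).

(** Bernoulli for (1/x)^x. It is exact at x = 1, which corresponds to p = 2, but falls to 1/2 as x
    tends to 0, where a constant bound takes over. *)
Lemma powR_self_ge x : 0 < x <= 1 -> (2 - x)^-1 <= x `^ x.
Proof.
move=> /andP[x0 x1].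
have x01 : 0 <= x <= 1 by rewrite ltW.
have xV0 : 0 <= x^-1 by rewrite invr_ge0 ltW.
have := powR_bernoulli_le x01 xV0.
rewrite mulrBr mulr1 mulfV ?gt_eqF// => h.
have xx : x `^ x = ((x^-1) `^ x)^-1.
  by rewrite -(powR_inv1 (ltW x0)) -powRrM mulN1r powRN invrK.
rewrite xx lef_pV2 ?posrE ?powR_gt0 ?invr_gt0//; last by lra.
by apply: le_trans h _; lra.
Qed.

(** Passing to r = sqrt x sharpens Bernoulli: the bound 1 + 2r - 2r^2 for x^(-x) peaks at 3/2, for r
    = 1/2. The range x <= 1/2 keeps the exponent 2x below 1. *)
Lemma powR_self_ge23 x : 0 < x <= 1 / 2 -> 2 / 3 <= x `^ x.
Proof.
move=> /andP[x0 x1]; pose r := Num.sqrt x.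
have r0 : 0 < r by rewrite sqrtr_gt0.
have r2 : r ^+ 2 = x by rewrite sqr_sqrtr// ltW.
have x01 : 0 <= 2 * x <= 1 by apply/andP; split; lra.
have rV0 : 0 <= r^-1 by rewrite invr_ge0 ltW.
have := powR_bernoulli_le x01 rV0.
have -> : 1 + 2 * x * (r^-1 - 1) = 1 + 2 * r - 2 * r ^+ 2.
  by rewrite -r2; field; rewrite gt_eqF.
have xx : x `^ x = ((r^-1) `^ (2 * x))^-1.
  rewrite -(powR_inv1 (ltW r0)) -powRrM mulN1r powRN invrK powRrM powR_mulrn ?r2//.
  exact: ltW.
move=> h; rewrite xx (_ : 2 / 3 = (3 / 2)^-1); last by rewrite invf_div.
rewrite lef_pV2 ?posrE ?powR_gt0 ?invr_gt0//.
apply: le_trans h _.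
have := sqr_ge0 (r - 1 / 2); lra.
Qed.

(** 2^(-1/2) <= 5/7 because 25/49 > 1/2; Bernoulli in the exponent s then gives the slope 2/7. *)
Lemma powR_half_le s : 0 <= s <= 1 -> (2^-1 : R) `^ (s / 2) <= 1 - 2 / 7 * s.
Proof.
move=> s01; rewrite mulrC powRrM.
set t := _ `^ (2^-1).
have t0 : 0 <= t by exact: powR_ge0.
have t2 : t ^+ 2 = 2^-1 by rewrite -powR_mulrn// -powRrM mulVf// powRr1.
have t57 : t <= 5 / 7 by nra.
have /andP[s0 s1] := s01.
by apply: le_trans (powR_bernoulli_le s01 t0) _; nra.
Qed.

Lemma kappa_ge : 128 / 100 <= kappa :> R.
Proof.
rewrite /kappa; suff : 28 / 100 <= (Num.sqrt 12)^-1 :> R by lra.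
have s0 : 0 < Num.sqrt 12 :> R by rewrite sqrtr_gt0.
rewrite -[leRHS]div1r ler_pdivlMr//.
have : Num.sqrt 12 ^+ 2 = 12 :> R by rewrite sqr_sqrtr.
by nra.
Qed.

Lemma Rfun_le_den s d : 0 < d -> d <= kappa * (kappa + s) * (2 * kappa + s) ->
  Rfun s <= s ^+ 2 / (24 * d).
Proof.
move=> d0 dle; rewrite /Rfun (_ : s ^+ 2 / (24 * d) = 24^-1 * (s ^+ 2 / d)); last first.
  by rewrite invfM mulrCA.
rewrite ler_pM2l ?invr_gt0//.
by rewrite ler_wpM2l ?sqr_ge0// lef_pV2 ?posrE//; exact: lt_le_trans dle.
Qed.

Lemma Rfun_neg_le18 s : 0 <= s <= 1 / 2 -> Rfun (- s) <= s ^+ 2 / 18.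
Proof.
move=> /andP[s0 s1]; have k1 := @kappa_ge.
have -> : s ^+ 2 / 18 = (- s) ^+ 2 / (24 * (3 / 4)) by rewrite sqrrN; field.
apply: Rfun_le_den; first by lra.
have h : 1 / 2 <= kappa * (kappa - s) :> R by nra.
by nra.
Qed.

(** Near s = 1 the factor kappa - s is small and s^2 / 18 is no longer an upper bound. An affine one
    keeps the final inequality quadratic. *)
Lemma Rfun_neg_le_affine s : 1 / 2 <= s <= 1 -> Rfun (- s) <= (7 * s - 3) / 50.
Proof.
move=> /andP[s0 s1]; have k1 := @kappa_ge.
pose d := (128 / 100) * (128 / 100 - s) * (256 / 100 - s).
have d0 : 0 < d by rewrite mulr_gt0 ?mulr_gt0; lra.
apply: (@le_trans _ _ ((- s) ^+ 2 / (24 * d))).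
  apply: Rfun_le_den => //; rewrite /d.
  apply: ler_pM; [|lra| |lra].
    by rewrite mulr_ge0; lra.
  by apply: ler_pM; lra.
have d24 : 0 < 24 * d by rewrite mulr_gt0.
rewrite sqrrN ler_pdivrMr// /d.
have : 0 <= (s - 1 / 2) * (1 - s) by rewrite mulr_ge0 ?subr_ge0.
nra.
Qed.

Lemma operator_norm_gt_small p : 1 < p -> p < 2 ->
  ((expR (Rfun (p - 2)))%:E < operator_norm p (cesaro_V p) `^ p)%E.
Proof.
move=> p1 p2; pose s := 2 - p.
have s0 : 0 < s by rewrite /s; lra.
have s1 : s < 1 by rewrite /s; lra.
have pE : p = 2 - s by rewrite /s; lra.
apply: lt_le_trans (operator_norm_ge_small p1 p2); rewrite lte_fin.
have p0 : 0 < p by lra.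
have pm1 : 0 < p - 1 by lra.
pose tau : R := (2^-1) `^ (s / 2).
have tau0 : 0 < tau by rewrite powR_gt0// invr_gt0.
have tau_le : tau <= 1 - 2 / 7 * s by apply: powR_half_le; rewrite !ltW.
set X := (p - 1) `^ (p - 1).
have X0 : 0 <= X by exact: powR_ge0.
have g1 : 1 + s <= (2 * p^-1) `^ p.
  have b0 : 0 <= 2 * p^-1 by rewrite mulr_ge0// invr_ge0 ltW.
  apply: le_trans (powR_bernoulli_ge (ltW p1) b0).
  have -> : p * (2 * p^-1 - 1) = 2 - p by field; rewrite gt_eqF.
  by rewrite /s.
(* With 2p - 1 = 3 - 2s and 2^(p/2) = 2 tau, each real power has become one with an elementary bound
   in s. *)
have rhoE : 2 `^ (p / 2) / 2 * (((p - 1) / p) `^ p * ((2 * p - 1) / (p - 1)) + p^-1 `^ p) =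
    (2 * p^-1) `^ p * (X * (3 - 2 * s) + 1) / (4 * tau).
  rewrite powRM ?invr_ge0 ?(ltW p0) ?(ltW pm1)// [in RHS]powRM ?invr_ge0 ?(ltW p0)//.
  have -> : (p - 1) `^ p = (p - 1) * X by rewrite mulr_powRB1// ltW.
  have -> : 2 `^ p = 2 `^ (p / 2) * 2 `^ (p / 2) :> R.
    by rewrite -powRD ?pnatr_eq0 ?implybT//; congr (_ `^ _); field.
  have -> : 2 `^ (p / 2) = 2 * tau :> R.
    have tauE : tau = 2 `^ (- (s / 2)).
      by rewrite /tau -(powR_inv1 (ler0n R 2)) -powRrM mulN1r.
    rewrite (_ : p / 2 = 1 - s / 2); last by rewrite /s; field.
    by rewrite powRD ?pnatr_eq0 ?implybT// powRr1 -?tauE.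
  by rewrite /s; field; rewrite !gt_eqF.
rewrite rhoE ltr_pdivlMr ?mulr_gt0//.
have den0 : 0 < 1 - 2 / 7 * s by lra.
(* [Q] bounds (1 + s) (X (3 - 2s) + 1) / 4 from below and [r] bounds R from above; a polynomial
   inequality in s remains. *)
have reduce Q r : Rfun (p - 2) <= r -> 0 <= r < 1 -> 4 * Q <= (1 + s) * (X * (3 - 2 * s) + 1) ->
    1 - 2 / 7 * s < Q * (1 - r) ->
    expR (Rfun (p - 2)) * (4 * tau) < (2 * p^-1) `^ p * (X * (3 - 2 * s) + 1).
  move=> Rr /andP[r0 r1] Qle Qr.
  have e1 : expR (Rfun (p - 2)) <= (1 - r)^-1.
    apply: le_trans (expR_le_inv _) _; first by apply: le_lt_trans r1.
    by rewrite lef_pV2 ?posrE ?subr_gt0//; lra.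
  apply: (@lt_le_trans _ _ (4 * Q)); last first.
    by apply: le_trans Qle _; rewrite ler_wpM2r// addr_ge0// mulr_ge0//; lra.
  apply: (@le_lt_trans _ _ ((1 - r)^-1 * (4 * (1 - 2 / 7 * s)))).
    by apply: ler_pM; rewrite ?expR_ge0 ?mulr_ge0 ?(ltW tau0)// ler_pM2l.
  by rewrite mulrC ltr_pdivrMr ?subr_gt0// -[ltRHS]mulrA ltr_pM2l.
have X1 : (1 + s)^-1 <= X.
  have := @powR_self_ge (p - 1); rewrite (_ : 2 - (p - 1) = 1 + s); last by rewrite /s; ring.
  by apply; apply/andP; split; lra.
have [s12|s12] := leP s (1 / 2).
  (* (1 + s) X >= 1 gives (3 - 2s) + (1 + s) = 4 - s. The first-order margin comes from 2/7 >
     1/4. *)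
  apply: (reduce (1 - s / 4) (s ^+ 2 / 18)).
  - rewrite (_ : p - 2 = - s); last by rewrite /s; ring.
    by apply: Rfun_neg_le18; rewrite (ltW s0).
  - by apply/andP; split; nra.
  - have h : 1 <= (1 + s) * X.
      have := ler_wpM2l (ltW (_ : 0 < 1 + s)) X1.
      by rewrite mulfV ?gt_eqF; [apply; lra|lra..].
    have h3 : 0 <= 3 - 2 * s by lra.
    have := ler_wpM2r h3 h; nra.
  - by nra.
have X23 : 2 / 3 <= X by apply: powR_self_ge23; apply/andP; split; lra.
(* With X >= 2/3 the lower bound (1 + s) (3 - 4s/3) is concave in s, and (11 - s) / 3 is its chord
   over [1/2, 1]. *)
apply: (reduce ((11 - s) / 12) ((7 * s - 3) / 50)).
- rewrite (_ : p - 2 = - s); last by rewrite /s; ring.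
  by apply: Rfun_neg_le_affine; rewrite (ltW s12) (ltW s1).
- by apply/andP; split; lra.
- have h3 : 0 <= 3 - 2 * s by lra.
  have h := ler_wpM2r h3 X23.
  apply: (@le_trans _ _ ((1 + s) * (2 / 3 * (3 - 2 * s) + 1))); first by nra.
  by rewrite ler_pM2l; lra.
- by nra.
Qed.

End SmallExponentBound.

Theorem proposition2 (R : realType) (p : R) (hp1 : 1 < p) (hp2 : p != 2) :
  (1 < operator_norm p (cesaro_V p))%E /\
  ((expR (Rfun (p - 2)))%:E < operator_norm p (cesaro_V p) `^ p)%E.
Proof.
have p0 : 0 < p by exact: lt_trans hp1.
have normp : ((expR (Rfun (p - 2)))%:E < operator_norm p (cesaro_V p) `^ p)%E.
  have [p2|p2] := ltP p 2; first exact: operator_norm_gt_small.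
  by apply: operator_norm_gt_large; rewrite lt_neqAle eq_sym hp2.
have R0 : 0 <= Rfun (p - 2).
  have k1 := @kappa_ge R.
  apply: mulr_ge0; first by rewrite invr_ge0.
  apply: divr_ge0; first exact: sqr_ge0.
  by apply: mulr_ge0; [apply: mulr_ge0; lra|lra].
have H : (1 < operator_norm p (cesaro_V p) `^ p)%E.
  by apply: le_lt_trans normp; rewrite lee_fin (le_trans _ (expR_ge1Dx _))// lerDl.
(* By convention a negative real has power 1 and -oo has power 0, so [H] excludes both; the value
   +oo is immediate. *)
split => //; move: (operator_norm _ _) H => [r| |].
- rewrite poweR_EFin !lte_fin; have [r0|r0] := leP 0 r; last by rewrite lt0_powR1// ltxx.
  rewrite !ltNge; apply: contra => r1.
  have := ge0_ler_powR (ltW p0) (_ : r \in Num.nneg) (_ : 1 \in Num.nneg) r1.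
  by rewrite !nnegrE powR1 => /(_ r0 ler01).
- by rewrite ltry.
- by rewrite poweRNyr ?gt_eqF// lte_fin ltr10.
Qed.
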